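(* Let $p$ be a prime and let $F$ be a finitely generated non-abelian free pro-$p$ group. Then $F$ has full Hausdorff spectrum $\mathrm{hspec}^{\mathcal{Z}}(F) = [0,1]$ with respect to the Zassenhaus series $\mathcal{Z}$ of $F$.
   Context: Subgroups of pro-$p$ groups are understood to be closed and generation is topological. A filtration of a finitely generated infinite pro-$p$ group $G$ is a descending chain $\mathcal{S}\colon G_i$ of open normal subgroups with trivial intersection (indexed by $i\in\mathbb{N}_0$ or $i\in\mathbb{N}$). The Hausdorff dimension of a closed subgroup $H\le G$ with respect to $\mathcal{S}$ is $$\mathrm{hdim}_G^{\mathcal{S}}(H) = \liminf_{i\to\infty} \frac{\log_p |HG_i:G_i|}{\log_p |G:G_i|}$$ (this equals the Hausdorff dimension for the metric $d(x,y)=\inf\{|G:G_i|^{-1} \mid x^{-1}y\in G_i\}$). The Hausdorff spectrum is $\mathrm{hspec}^{\mathcal{S}}(G) = \{\mathrm{hdim}_G^{\mathcal{S}}(H) \mid H \le G \text{ a closed subgroup}\}$. The Zassenhaus series $\mathcal{Z}\colon Z_i(G)$, $i\in\mathbb{N}$, is defined by $Z_1(G)=G$ and $Z_i(G) = Z_{\lceil i/p\rceil}(G)^p \prod_{1\le j<i}[Z_j(G),Z_{i-j}(G)]$ for $i\ge2$. *)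

(* Defs.v *)
From HB Require Import structures.
From mathcomp Require Import all_boot all_order all_algebra.
From mathcomp Require Import finmap zify.
From mathcomp Require Import all_classical all_reals all_analysis.

Set Implicit Arguments.
Unset Strict Implicit.
Unset Printing Implicit Defensive.

Local Open Scope classical_set_scope.
Local Open Scope group_scope.

HB.mixin Record isTopGroup G of Group G & Topological G := {
  mulg_continuous : continuous (fun z : G * G => z.1 * z.2);
  invg_continuous : continuous (fun x : G => x^-1)
}.

#[short(type="topGroupType")]
HB.structure Definition TopGroup := {G of isTopGroup G & Group G & Topological G}.

Section Subgroups.
Variable G : topGroupType.
Implicit Types A B H N : set G.

Definition subgroup H : Prop :=
  [/\ H 1, (forall x y, H x -> H y -> H (x * y)) & (forall x, H x -> H x^-1)].

Definition closed_subgroup H : Prop := subgroup H /\ closed H.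

Definition open_normal_subgroup N : Prop :=
  [/\ subgroup N, open N & forall x y, N x -> N (x ^ y)].

Definition topgen A : set G := smallest closed_subgroup A.

Definition mulset A B : set G := [set x * y | x in A & y in B].

(* A^n and [A, B] in the category of profinite groups: generation is
   topological. *)
Definition powers A (n : nat) : set G := topgen [set x ^+ n | x in A].
Definition commutators A B : set G := topgen [set [~ x, y] | x in A & y in B].

Definition left_cosets A N : set (set G) := [set [set x * y | y in N] | x in A].

(* |A : N| when A is a subgroup containing N. The junk value 0 occurs only for
   infinite index, hence never for an open N in a compact G. *)
Definition group_index A N : nat := #|` fset_set (left_cosets A N)|%fset.

Definition finitely_generated : Prop :=
  exists A : set G, finite_set A /\ topgen A = [set: G].

Definition nonabelian : Prop := ~ forall x y : G, commute x y.

Definition pro_p (p : nat) : Prop :=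
  [/\ compact [set: G], hausdorff_space G, totally_disconnected [set: G] &
      forall N, open_normal_subgroup N ->
        exists k : nat, group_index [set: G] N = (p ^ k)%N].

Definition converges_to_one (X : Type) (f : X -> G) : Prop :=
  forall U : set G, nbhs (1 : G) U -> finite_set [set x | ~ U (f x)].

End Subgroups.

Arguments finitely_generated : clear implicits.
Arguments nonabelian : clear implicits.
Arguments pro_p : clear implicits.

(* Free pro-p groups via the universal property of a basis converging to 1;
   for a finite basis the convergence conditions are void. *)
Definition free_pro_p_on (p : nat) (F : topGroupType) (X : Type) (b : X -> F)
    : Prop :=
  [/\ pro_p F p, converges_to_one b &
      forall (P : topGroupType) (f : X -> P),
        pro_p P p -> converges_to_one f ->
        exists! phi : F -> P,
          [/\ {morph phi : x y / x * y}, continuous phi &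
              forall x, phi (b x) = f x]].

Definition free_pro_p (p : nat) (F : topGroupType) : Prop :=
  exists (X : Type) (b : X -> F), free_pro_p_on p b.

Section Zassenhaus.
Variables (p : nat) (G : topGroupType).

(* (i + p.-1) %/ p is the ceiling of i / p. *)
Definition zassenhaus_step (Z : nat -> set G) (i : nat) : set G :=
  mulset (powers (Z ((i + p.-1) %/ p)%N) p)
    (\big[@mulset G/[set 1]]_(1 <= j < i) commutators (Z j) (Z (i - j)%N)).

(* The first argument is fuel, see zassenhausE. *)
Fixpoint zassenhaus_rec (n i : nat) : set G :=
  if n is n'.+1 then
    if (i <= 1)%N then [set: G] else zassenhaus_step (zassenhaus_rec n') i
  else [set: G].

(* The index 0, which is not part of the series, gets the value G. *)
Definition zassenhaus (i : nat) : set G := zassenhaus_rec i i.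

Lemma zassenhaus1 : zassenhaus 1 = [set: G].
Proof. by []. Qed.

Lemma zassenhaus_ceil_lt i : (1 < p)%N -> (1 < i)%N -> ((i + p.-1) %/ p < i)%N.
Proof.
case: p => [|[|q]] // _; case: i => [|[|i]] // _.
by rewrite ltn_divLR //=; nia.
Qed.

Lemma zassenhaus_fuel n m i : (1 < p)%N -> (i <= n)%N -> (i <= m)%N ->
  zassenhaus_rec n i = zassenhaus_rec m i.
Proof.
move=> p1; elim: n m i => [|n IH] [|m] [|i] //= lin lim.
case: ifPn => // /negbTE; rewrite ltnNge => /negbFE i0.
have clt : ((i.+1 + p.-1) %/ p < i.+1)%N by apply: zassenhaus_ceil_lt.
rewrite /zassenhaus_step; congr (mulset (powers _ _) _).
  by apply: IH; lia.
apply: eq_big_nat => j /andP[j0 ji].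
by congr commutators; apply: IH; lia.
Qed.

Lemma zassenhausE i : (1 < p)%N -> (2 <= i)%N ->
  zassenhaus i = zassenhaus_step zassenhaus i.
Proof.
move=> p1 i2; rewrite {1}/zassenhaus; case: i i2 => [|[|i]] // _.
rewrite -[LHS]/(zassenhaus_step (zassenhaus_rec i.+1) i.+2).
have clt := zassenhaus_ceil_lt p1 (isT : 1 < i.+2)%N.
rewrite /zassenhaus_step; congr (mulset (powers _ _) _).
  by apply: zassenhaus_fuel => //; lia.
apply: eq_big_nat => j /andP[j0 ji].
by congr commutators; apply: zassenhaus_fuel => //; lia.
Qed.

End Zassenhaus.

Section HausdorffDimension.
Local Open Scope ring_scope.
Variables (R : realType) (p : nat) (G : topGroupType).

Definition logp (n : nat) : R := ln n%:R / ln p%:R.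

(* A term with G_i = G reads 0 / 0 = 0; for a filtration of an infinite group
   this affects only finitely many terms. *)
Definition hdim (S : nat -> set G) (H : set G) : \bar R :=
  limn_einf (fun i =>
    (logp (group_index (mulset H (S i)) (S i)) /
     logp (group_index [set: G] (S i)))%:E).

Definition hspec (S : nat -> set G) : set (\bar R) :=
  [set hdim S H | H in @closed_subgroup G].

End HausdorffDimension.

Arguments logp : clear implicits.
Arguments hdim R p {G} S H.
Arguments hspec R p {G} S.
Arguments zassenhaus p G i : clear implicits.

(* Main.v *)
(** Write Z_n for the Zassenhaus series, a_n = log_p |F : Z_n| and
    h_n(H) = log_p |H Z_n : Z_n|, let x, y_1, ..., y_(d-1) be a basis of F and let
    D be the union of the subgroups E_m generated by the Engel commutators
    [y_k, x, ..., x] with at most m entries x.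

    Since x normalizes D modulo every Z_n and x^(p^n) lies in Z_n, one has
    h_n(D) >= a_n - n, so D is as large as F.  On the other hand each E_m is
    negligible: h_n(E_m) / a_n tends to 0.  Indeed, for a finite p-group with an
    N_p-series that reaches 1 at step n, the group algebra over F_p carries a
    filtration compatible with the series (Jennings), so a subgroup generated by
    elements s_i of weight w_i has order at most p^N, where N is the number of words
    in the s_i of weight < n; for E_m this number grows like lambda^n with
    lambda < d.  Conversely a_n grows faster than rho^n for each rho < d: with
    q = p^e and t running over the words without factor x^q, the commutators
    [x^q, t_l, ..., t_1] are linearly independent in the truncated free associative
    algebra, because the monomial t_1 ... t_l x^q occurs in only one of them.

    Given alpha in [0, 1], build K_0 <= K_1 <= ... inside D, each K_n contained
    in some E_m, by adjoining to K_n elements of D /\ Z_n until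
    h_(n+1) >= alpha h_(n+1)(D).  Each adjunction raises h_(n+1) by at most 1 and does
    not change h_n, and if D /\ Z_n is exhausted then the index of K_n in D has not
    grown, so the inequality holds anyway.  As the E_m are negligible, elements are
    adjoined infinitely often, and at those n the value is at most
    alpha h_(n+1)(D) + 1.  So the subgroup generated by the K_n has dimension alpha. *)

Require Import Defs.
From HB Require Import structures.
From mathcomp Require Import all_boot all_order all_algebra all_fingroup all_solvable.
From mathcomp Require Import zify ring lra boolp.

Set Implicit Arguments.
Unset Strict Implicit.
Unset Printing Implicit Defensive.

Section FiniteGroupsAndCounting.
Import Order.TTheory GRing.Theory Num.Theory.
Local Open Scope ring_scope.

(** * Upper bound for the order of a group with an N_p-series *)

Lemma exprBn1_prime (R : pzRingType) (p : nat) (x : R) :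
  prime p -> p%:R = 0 :> R -> (x - 1) ^+ p = x ^+ p - 1.
Proof.
move=> p_pr p0; apply/eqP; rewrite eq_sym subr_eq; apply/eqP.
rewrite -{1}(subrK 1 x) (@exprDn_comm _ _ 1); last exact: commr1.
case: p p_pr p0 => // q p_pr p0; rewrite big_ord_recl big_ord_recr /=.
rewrite subn0 subnn expr0 !expr1n !mulr1 bin0 mulr1n binn mulr1n big1 ?add0r //.
move=> i _; have i_lt := ltn_ord i.
have /dvdnP[k ->] : (q.+1 %| 'C(q.+1, bump 0 i))%N.
  by apply: prime_dvd_bin => //; rewrite /bump /=; lia.
by rewrite -mulr_natr natrM p0 !mulr0.
Qed.

(** An N_p-series in the sense of Lazard, indexed from 0: the case [i = 0] of [np_seriesR] says that
    [P 0] normalizes every [P j]. *)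
Record np_series (p : nat) (gT : finGroupType) (P : nat -> {group gT}) : Prop := NpSeries {
  np_seriesS : forall i, P i.+1 \subset P i;
  np_seriesR : forall i j x y, x \in P i -> y \in P j -> [~ x, y]%g \in P (i + j)%N;
  np_seriesX : forall i x, x \in P i -> (x ^+ p)%g \in P (p * i)%N }.

Section Jennings.
Variables (p : nat) (gT : finGroupType) (P : nat -> {group gT}).
Hypothesis p_pr : prime p.
Hypothesis npP : np_series p P.

Let PS := np_seriesS npP.
Let PR := np_seriesR npP.
Let PX := np_seriesX npP.

Notation V := 'rV['F_p]_#|gT|.

Definition gbase (x : gT) : V := delta_mx 0 (enum_rank x).
Definition gact (g : gT) : 'M['F_p]_#|gT| := \matrix_i gbase (enum_val i * g)%g.

Lemma np_series_le i j : (i <= j)%N -> P j \subset P i.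
Proof.
move=> /subnK <-; elim: (j - i)%N => // k IH.
exact: subset_trans (PS _) IH.
Qed.

Lemma np_series_mem_le i j x : (i <= j)%N -> x \in P j -> x \in P i.
Proof. by move=> /np_series_le /subsetP; apply. Qed.

Lemma gbase_act x g : gbase x *m gact g = gbase (x * g)%g.
Proof. by rewrite /gbase -rowE rowK enum_rankK. Qed.

Lemma gact_act (v : V) g x : (v *m gact g) 0 (enum_rank x) = v 0 (enum_rank (x * g^-1)%g).
Proof.
rewrite mxE (bigD1 (enum_rank (x * g^-1)%g)) //= big1 ?addr0 => [|i ni].
  by rewrite !mxE enum_rankK mulgKV !eqxx mulr1.
rewrite !mxE eqxx /=; case: eqP => [/enum_rank_inj E|]; rewrite ?mulr0 //.
by case/eqP: ni; apply: enum_val_inj; rewrite enum_rankK E mulgK.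
Qed.

Lemma gact1 : gact 1 = 1%:M.
Proof.
apply/row_matrixP => i; rewrite rowK mulg1 /gbase enum_valK.
by rewrite -row1.
Qed.

Lemma gactM g h : gact (g * h)%g = gact g *m gact h.
Proof. by apply/row_matrixP => i; rewrite row_mul !rowK gbase_act mulgA. Qed.

Lemma gactX g k : gact (g ^+ k)%g = gact g ^+ k.
Proof. by elim: k => [|k IH]; rewrite ?gact1 // expgS exprS gactM IH. Qed.

(* A filtration of the group algebra of M, realized as the row vectors supported
   on M with [gact g] as right translation. *)
Record filtered (M : {set gT}) (W : nat -> V -> Prop) : Prop := Filtered {
  filt_add : forall l v w, W l v -> W l w -> W l (v + w);
  filt_scale : forall l c v, W l v -> W l (c *: v);
  filt_S : forall l v, W l.+1 v -> W l v;
  filt_supp : forall l v x, W l v -> x \notin M -> v 0 (enum_rank x) = 0;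
  filt_1 : W 0%N (gbase 1);
  filt_act : forall l i h v, h \in M -> h \in P i -> W l v ->
    W (l + i)%N (v *m (gact h - 1%:M));
  filt_inj : forall n h, h \in M -> W n (gbase h - gbase 1) -> h \in P n;
  filt_proper : ~ W 1%N (gbase 1) }.

(** * Extension of a filtration from [M] to a group containing [M] with index p *)

Section Step.
Variables (M : {group gT}) (W : nat -> V -> Prop) (w : nat) (g : gT).
Hypothesis filtW : filtered M W.
Hypothesis w_gt0 : (0 < w)%N.
Hypothesis MPw : M \subset P w.
Hypothesis PwM : P w.+1 \subset M.
Hypothesis gPw : g \in P w.
Hypothesis gM : g \notin M.

Let N := gact g - 1%:M.

Lemma filt_le l l' v : (l <= l')%N -> W l' v -> W l v.
Proof.
move=> /subnK <-; elim: (l' - l)%N => // k IH W'.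
exact/IH/(filt_S filtW).
Qed.

Lemma filt0 l : W l 0.
Proof.
have : W (0 + l)%N (gbase 1 *m (gact 1 - 1%:M)).
  exact: (filt_act filtW) (group1 _) (group1 _) (filt_1 filtW).
by rewrite gact1 subrr mulmx0.
Qed.

Lemma stepX : (g ^+ p)%g \in M.
Proof.
apply: (subsetP PwM); apply: np_series_mem_le (PX gPw).
by have := prime_gt1 p_pr; nia.
Qed.

Lemma stepR h : h \in P w -> [~ g^-1, h^-1]%g \in M.
Proof.
move=> hP; apply: (subsetP PwM).
apply: (@np_series_mem_le _ (w + w)%N); first lia.
by apply: PR; rewrite groupV.
Qed.

Lemma step_conj h : h \in M -> (g * h * g^-1)%g \in M.
Proof.
move=> hM; have -> : (g * h * g^-1 = [~ g^-1, h^-1] * h)%g.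
  by rewrite /commg /conjg !invgK !mulgA mulgKV.
by rewrite groupM // stepR // (subsetP MPw).
Qed.

(** [g] has order [p] modulo [M]: by Bezout, [g] is a power of [g ^+ d] up to a power of [g ^+ p],
    which lies in [M] by [stepX]. *)
Lemma stepX_notin d : (0 < d < p)%N -> (g ^+ d)%g \notin M.
Proof.
move=> /andP[d0 dp]; apply: contra gM => gd.
have co : coprime d p by rewrite coprime_sym prime_coprime // gtnNdvd.
have [a b E _] := egcdnP p d0; rewrite (eqP co : gcdn d p = 1%N) in E.
have : (g ^+ (a * d))%g \in M by rewrite mulnC expgM groupX.
by rewrite E expgD expg1 mulnC expgM groupMl // groupX // stepX.
Qed.

(** The group algebra of the larger group is free over that of [M] on the powers [N ^ j] with
    [j < p], where [N = g - 1] receives weight [w]. The truncated subtraction allows any coefficient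
    in [W 0] once [j * w] reaches [l]. The bound [k] is kept general for inductions; the filtration
    itself is the case [k = p]. *)
Definition stepU k l (v : V) := exists2 a : nat -> V,
  (forall j, (j < k)%N -> W (l - j * w)%N (a j)) &
  v = \sum_(j < k) a j *m N ^+ j.

Lemma stepU_add k l v v' : stepU k l v -> stepU k l v' -> stepU k l (v + v').
Proof.
move=> [a Wa ->] [b Wb ->]; exists (fun j => a j + b j).
  by move=> j jk; apply: (filt_add filtW); [apply: Wa | apply: Wb].
by rewrite -big_split; apply: eq_bigr => i _; rewrite mulmxDl.
Qed.

Lemma stepU_scale k l c v : stepU k l v -> stepU k l (c *: v).
Proof.
move=> [a Wa ->]; exists (fun j => c *: a j).
  by move=> j jk; apply: (filt_scale filtW); apply: Wa.
by rewrite scaler_sumr; apply: eq_bigr => i _; rewrite scalemxAl.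
Qed.

Lemma stepU_le k l l' v : (l <= l')%N -> stepU k l' v -> stepU k l v.
Proof.
move=> ll [a Wa ->]; exists a => // j jk; apply: filt_le (Wa _ jk); lia.
Qed.

(** Horner form: one right factor [N] is split off, so that an induction on [k] moves group elements
    past a single [N] at a time. *)
Lemma stepU_consP k l v : stepU k.+1 l v <->
  exists a u, [/\ W l a, stepU k (l - w)%N u & v = a + u *m N].
Proof.
have sumE (a : nat -> V) : \sum_(j < k) a j.+1 *m N ^+ j.+1 =
    (\sum_(j < k) a j.+1 *m N ^+ j) *m N.
  by rewrite mulmx_suml; apply: eq_bigr => i _; rewrite exprSr mulmxA.
split=> [[a Wa ->]|[a0 [u [Wa0 [a Wa ->] ->]]]].
  exists (a 0%N), (\sum_(j < k) a j.+1 *m N ^+ j); split.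
  - by have := Wa 0%N isT; rewrite subn0.
  - exists (fun j => a j.+1) => // j jk; have := Wa j.+1 jk.
    by congr W; lia.
  by rewrite big_ord_recl expr0 mulmx1 -sumE.
exists (fun j => if j is j'.+1 then a j' else a0).
  case=> [|j] jk; first by rewrite subn0.
  by have := Wa j jk; congr W; lia.
by rewrite big_ord_recl expr0 mulmx1 (sumE (fun j => if j is j'.+1 then a j' else a0)).
Qed.

Lemma stepU0 l v : stepU 0 l v <-> v = 0.
Proof.
split=> [[a _ ->]|->]; first by rewrite big_ord0.
by exists (fun=> 0) => //; rewrite big_ord0.
Qed.

Lemma stepU_zero k l : stepU k l 0.
Proof.
exists (fun=> 0); first by move=> *; apply: filt0.
by rewrite big1 // => i _; rewrite mul0mx.
Qed.

Lemma stepU_rcons k l v : stepU k.+1 l v ->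
  exists a u, [/\ W (l - k * w)%N a, stepU k l u & v = u + a *m N ^+ k].
Proof.
move=> [a Wa ->]; exists (a k), (\sum_(j < k) a j *m N ^+ j); split.
- exact: Wa.
- by exists a => // j jk; apply: Wa; apply: ltnW.
by rewrite big_ord_recr.
Qed.

Lemma stepU_widen k l v : stepU k l v -> stepU k.+1 l v.
Proof.
move=> [a Wa ->]; exists (fun j => if (j < k)%N then a j else 0).
  by move=> j _; case: ifP => // jk; [apply: Wa | apply: filt0].
rewrite big_ord_recr /= ltnn mul0mx addr0.
by apply: eq_bigr => i _; rewrite ltn_ord.
Qed.

(* Here [A_g A_h = A_{h'} A_g] with [h' = c h] and [c] of weight [i + w], so
   [N (A_h - 1) = (A_{h'} - 1) N + (A_c - 1) A_h]. *)
Lemma stepU_actM k l i h v : h \in M -> h \in P i -> stepU k l v ->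
  stepU k (l + i)%N (v *m (gact h - 1%:M)).
Proof.
have le1 a b : (a + b <= a - w + (b + w))%N by clear; lia.
have le2 a b : (a + b - w <= a - w + b)%N by clear; lia.
elim: k l i h v => [|k IH] l i h v hM hi.
  by move/stepU0->; rewrite mul0mx; apply/stepU0.
move=> /stepU_consP[a [u [Wa Uu ->]]].
set h' := (g * h * g^-1)%g; set c := [~ g^-1, h^-1]%g.
have hP := subsetP MPw _ hM.
have cM : c \in M by apply: stepR.
have h'M : h' \in M by apply: step_conj.
have cP : c \in P (i + w)%N by rewrite addnC; apply: PR; rewrite groupV.
have h'E : h' = (c * h)%g.
  by rewrite /h' /c /commg /conjg !invgK !mulgA mulgKV.
have h'P : h' \in P i.
  by rewrite h'E groupM //; apply: np_series_mem_le cP; rewrite leq_addr.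
have NE : N *m (gact h - 1%:M) = (gact h' - 1%:M) *m N + (gact c - 1%:M) *m gact h.
  rewrite /N !mulmxBl !mulmxBr !mul1mx !mulmx1 -!gactM -h'E.
  rewrite /h' mulgKV; move: (gact _) (gact _) (gact _) (gact _) 1%:M => x y z t o.
  rewrite !opprB !addrA [t - x + o]addrAC [_ - z + x]addrAC subrK.
  by rewrite [t - z + o]addrAC.
(* The part [u] has lost the weight [w], and the weight [i + w] of [c] makes up for it. *)
have Uc : stepU k (l + i)%N (u *m ((gact c - 1%:M) *m gact h)).
  have Uy : stepU k (l + i)%N (u *m (gact c - 1%:M)).
    by apply: stepU_le (le1 l i) (IH _ _ _ _ cM cP Uu).
  rewrite mulmxA -[gact h](subrK 1%:M) mulmxDr mulmx1.
  apply: stepU_add => //.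
  by have := IH _ 0%N _ _ hM (np_series_mem_le (leq0n _) hi) Uy; rewrite addn0.
rewrite mulmxDl -mulmxA NE mulmxDr [X in _ + X]addrC addrA.
apply: stepU_add; last first.
  rewrite mulmxA; apply/stepU_consP; exists 0, (u *m (gact h' - 1%:M)).
  split; [exact: filt0| |by rewrite add0r].
  by apply: stepU_le (le2 l i) (IH _ _ _ _ h'M h'P Uu).
apply: stepU_add; last exact: stepU_widen.
apply/stepU_consP; exists (a *m (gact h - 1%:M)), 0.
by split; rewrite ?mul0mx ?addr0 //; [apply: (filt_act filtW) | apply: stepU_zero].
Qed.

Lemma stepU_incl k l a : W l a -> stepU k.+1 l a.
Proof.
move=> Wa; apply/stepU_consP; exists a, 0.
by split; rewrite ?mul0mx ?addr0 //; apply: stepU_zero.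
Qed.

Lemma prime_predK : p = p.-1.+1. Proof. by rewrite prednK ?prime_gt0. Qed.

Lemma stepNp : N ^+ p = gact (g ^+ p)%g - 1%:M.
Proof.
rewrite gactX /N -exprBn1_prime // -[1]/(1%:M) -raddfMn /=.
by rewrite (pcharf0 (pchar_Fp p_pr)) raddf0.
Qed.

(** Multiplication by [N] creates a term in [N ^ p], which is [g ^+ p - 1] in characteristic p. As
    [g ^+ p] lies in [M] and in [P (p * w)], this term falls back into the constant coefficient
    without loss of weight. *)
Lemma stepU_actN l v : stepU p l v -> stepU p (l + w)%N (v *m N).
Proof.
have le a : (a + w <= a + w - p * w + p * w)%N by clear; lia.
move=> Uv; have : stepU p.+1 (l + w)%N (v *m N).
  apply/stepU_consP; exists 0, v; split; [exact: filt0| |by rewrite add0r].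
  by rewrite addnK.
move=> /stepU_rcons[a [u [Wa Uu ->]]]; apply: stepU_add Uu _.
rewrite {1}prime_predK; apply: stepU_incl; rewrite stepNp.
by apply: filt_le (le l) _; apply: (filt_act filtW) (PX gPw) Wa; apply: stepX.
Qed.

Lemma stepU_actg l v : stepU p l v -> stepU p l (v *m gact g).
Proof.
move=> Uv; rewrite -[gact g](subrK 1%:M) mulmxDr mulmx1.
by apply: stepU_add => //; apply: stepU_le (stepU_actN Uv); apply: leq_addr.
Qed.

Lemma stepU_actgX l v e : stepU p l v -> stepU p l (v *m gact (g ^+ e)%g).
Proof.
elim: e v => [|e IH] v Uv; first by rewrite gact1 mulmx1.
by rewrite expgS gactM mulmxA; apply/IH/stepU_actg.
Qed.

Lemma stepU_actNX l v e : stepU p l v ->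
  stepU p (l + w)%N (v *m (gact (g ^+ e)%g - 1%:M)).
Proof.
move=> Uv; elim: e => [|e IH]; first by rewrite gact1 subrr mulmx0; apply: stepU_zero.
rewrite (_ : gact _ - _ = (gact g - 1%:M) *m gact (g ^+ e)%g + (gact (g ^+ e)%g - 1%:M)).
  by rewrite mulmxDr mulmxA; apply: stepU_add => //; apply/stepU_actgX/stepU_actN.
by rewrite expgS gactM mulmxBl mul1mx addrA subrK.
Qed.

(** The expansion of [N ^ j] only involves [g ^+ i] with [i <= j <= k], and the cosets of these
    powers are distinct; so the coset of [g ^+ k] is reached only if [j = k], and then with
    coefficient 1. *)
Lemma coefN (a : V) j k x : (forall y, y \notin M -> a 0 (enum_rank y) = 0) ->
  x \in M -> (j <= k < p)%N ->
  (a *m N ^+ j) 0 (enum_rank (x * g ^+ k)%g) = a 0 (enum_rank x) *+ (j == k).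
Proof.
move=> a_supp xM; elim: j k => [|j IH] [|k] //=.
- by rewrite expr0 mulmx1 mulg1.
- move=> kp; rewrite expr0 mulmx1 a_supp // groupMl //.
  exact: (stepX_notin (d := k.+1)).
move=> /andP[jk kp]; rewrite exprSr mulmxA /N mulmxBr mulmx1 mxE gact_act.
rewrite expgSr -!mulgA mulgV mulg1 IH; last by rewrite -ltnS jk ltnW.
by rewrite -expgSr mxE IH ?(ltnW jk) // (@ltn_eqF j k.+1) // mulr0n subr0 eqSS.
Qed.

(** Uniqueness of expansions in powers of [N]: by [coefN] the coset of the highest power of [g]
    determines the top coefficient, which is then removed. *)
Lemma sumN_eq0 (a : nat -> V) k :
  (forall j y, (j < k)%N -> y \notin M -> a j 0 (enum_rank y) = 0) ->
  (k <= p)%N -> \sum_(j < k) a j *m N ^+ j = 0 ->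
  forall j, (j < k)%N -> a j = 0.
Proof.
elim: k => [//|k IH] supp kp; rewrite big_ord_recr /= => S0.
have ak : a k = 0.
  apply/rowP => i; rewrite -(enum_valK i) [RHS]mxE; set x := enum_val i.
  have [xM|xM] := boolP (x \in M); last exact: supp.
  have := congr1 (fun v : V => v 0 (enum_rank (x * g ^+ k)%g)) S0.
  rewrite mxE summxE big1 ?add0r => [|j _].
    by rewrite coefN ?leqnn ?eqxx ?mxE // => y; apply: supp.
  rewrite coefN //; last 2 first.
  - by move=> y; apply: supp; rewrite ltnS ltnW.
  - by rewrite ltnW //=.
  by rewrite ltn_eqF.
rewrite ak mul0mx addr0 in S0.
move=> j; rewrite ltnS leq_eqVlt => /predU1P[->//|].
by apply: IH => //; [move=> j' y jk; apply: supp; apply: ltnW | apply: ltnW].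
Qed.

Lemma stepU_coef l (b : nat -> V) :
  (forall j y, (j < p)%N -> y \notin M -> b j 0 (enum_rank y) = 0) ->
  stepU p l (\sum_(j < p) b j *m N ^+ j) ->
  forall j, (j < p)%N -> W (l - j * w)%N (b j).
Proof.
move=> suppb [a Wa E] j jp.
suff /(_ j jp)/eqP : forall j, (j < p)%N -> b j - a j = 0.
  by rewrite subr_eq0 => /eqP ->; apply: Wa.
apply: (@sumN_eq0 (fun j => b j - a j) p) => //.
  move=> i y ip yM; rewrite mxE suppb // mxE (filt_supp filtW (Wa _ ip)) //.
  by rewrite subr0.
under eq_bigr do rewrite mulmxBl.
by rewrite sumrB E subrr.
Qed.

Lemma gbase_supp (x y : gT) : x != y -> gbase x 0 (enum_rank y) = 0.
Proof.
by move=> xy; rewrite mxE eqxx /= (inj_eq enum_rank_inj) eq_sym (negbTE xy).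
Qed.

Variable M' : {group gT}.
Hypothesis MM' : M \subset M'.
Hypothesis gM' : g \in M'.
Hypothesis M'P : forall x, x \in M' ->
  exists m e, [/\ m \in M, (e < p)%N & x = (m * g ^+ e)%g].

Lemma gbase_expand m e : (e < p)%N ->
  gbase (m * g ^+ e)%g = \sum_(j < p) ('C(e, j)%:R *: gbase m) *m N ^+ j.
Proof.
move=> ep; rewrite -gbase_act gactX -[gact g](subrK 1%:M) -/N addrC.
rewrite exprDn_comm; last exact/commr_sym/commr1.
rewrite mulmx_sumr (big_ord_widen p (fun i => gbase m *m (1%:M ^+ (e - i) * N ^+ i *+ 'C(e, i)))) //.
rewrite big_mkcond; apply: eq_bigr => i _; case: ltnP => ie.
  by rewrite expr1n mul1r -scalemxAl scalemxAr -scaler_nat.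
by rewrite bin_small // scale0r mul0mx.
Qed.

Lemma filt_translate l m : m \in M -> W l (gbase m) -> W l (gbase 1).
Proof.
move=> mM Wm; rewrite -(mulgV m) -gbase_act -[gact _](subrK 1%:M) mulmxDr mulmx1.
apply: (filt_add filtW) => //; rewrite -[l]addn0.
apply: (filt_act filtW) => //; first by rewrite groupV.
by rewrite groupV; apply: np_series_mem_le (subsetP MPw _ mM).
Qed.

(** The action is handled through [m * g^e - 1 = (m - 1) * g^e + (g^e - 1)]. The properties
    [filt_inj] and [filt_proper] are obtained by comparing coefficients of powers of [N], as
    [stepU_coef] permits. *)
Lemma step_filtered : filtered M' (stepU p).
Proof.
have gbM m y : m \in M -> y \notin M -> gbase m 0 (enum_rank y) = 0.
  by move=> mM yM; apply: gbase_supp; apply: contraNneq yM => <-.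
have p_gt0 := prime_gt0 p_pr.
have sum1E : \sum_(j < p) ((val j == 0%N)%:R *: gbase 1) *m N ^+ j = gbase 1.
  rewrite (bigD1 (Ordinal p_gt0)) //= expr0 mulmx1 scale1r big1 ?addr0 // => i.
  by rewrite -val_eqE /= => /negbTE ->; rewrite scale0r mul0mx.
split.
- by move=> l v v'; apply: stepU_add.
- by move=> l c v; apply: stepU_scale.
- by move=> l v; apply: stepU_le.
- move=> l v x [a Wa ->] xM'; rewrite summxE big1 // => j _.
  move: {2}(j : nat) => k; elim: k x xM' => [|k IH] x xM'.
    rewrite expr0 mulmx1 (filt_supp filtW (Wa _ (ltn_ord j))) //.
    by apply: contra xM'; apply: (subsetP MM').
  rewrite exprSr mulmxA /N mulmxBr mulmx1 mxE gact_act IH; last by rewrite groupMr // groupV.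
  by rewrite mxE IH // subr0.
- by rewrite prime_predK; apply/stepU_incl/(filt_1 filtW).
- move=> l i h v hM' hi Uv; have [hM|hM] := boolP (h \in M).
    exact: stepU_actM.
  (* An element outside [M] has weight at most [w], as [P w.+1] lies in [M]; so the gain of [w] from
     a power of [g] is enough. *)
  have iw : (i <= w)%N.
    rewrite leqNgt; apply: contra hM => wi.
    by apply: (subsetP PwM); apply: np_series_mem_le hi.
  have [m [e [mM ep hE]]] := M'P hM'.
  have mi : m \in P i.
    rewrite -[m](mulgK (g ^+ e)%g) -hE groupM // groupV groupX //.
    exact: np_series_mem_le gPw.
  rewrite hE (_ : _ - _ = (gact m - 1%:M) *m gact (g ^+ e)%g + (gact (g ^+ e)%g - 1%:M)).
    rewrite mulmxDr mulmxA; apply: stepU_add.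
      exact/stepU_actgX/stepU_actM.
    by apply: stepU_le (stepU_actNX e Uv); rewrite leq_add2l.
  by rewrite gactM mulmxBl mul1mx addrA subrK.
- move=> n h hM'; have [m [e [mM ep ->]]] := M'P hM'.
  pose b j : V := 'C(e, j)%:R *: gbase m - (j == 0%N)%:R *: gbase 1.
  have -> : gbase (m * g ^+ e)%g - gbase 1 = \sum_(j < p) b j *m N ^+ j.
    under eq_bigr do rewrite mulmxBl.
    rewrite sumrB -gbase_expand //; congr (_ - _).
    by rewrite sum1E.
  move=> /stepU_coef Wb; have {}Wb := Wb _.
  have suppb j y : (j < p)%N -> y \notin M -> b j 0 (enum_rank y) = 0.
    by move=> _ yM; rewrite mxE mxE gbM // mxE mxE gbM // !mulr0 subr0.
  have {Wb suppb}Wb := Wb suppb.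
  (* The constant coefficient of [m * g ^+ e - 1] is [m - 1]. *)
  have mn : m \in P n.
    have := Wb 0%N p_gt0; rewrite /b bin0 !scale1r mul0n subn0.
    exact: (filt_inj filtW).
  rewrite groupM //; case: e ep @b Wb => [|e] ep b Wb; first exact: group1.
  (* The coefficient of [N] is a nonzero multiple of [m]. If [w < n], it has positive level, so that
     [m], and then 1, would lie in [W 1]. *)
  suff nw : (n <= w)%N by rewrite groupX // (np_series_mem_le nw gPw).
  rewrite leqNgt; apply/negP => wn; apply: (filt_proper filtW).
  apply: (@filt_translate _ m mM).
  have := Wb 1%N (prime_gt1 p_pr); rewrite /b bin1 scale0r subr0 mul1n => W1.
  have e0 : (e.+1)%:R != 0 :> 'F_p.
    by rewrite -(dvdn_pcharf (pchar_Fp p_pr)) gtnNdvd.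
  rewrite -[gbase m](scalerK e0); apply: (filt_scale filtW).
  by apply: filt_le W1; rewrite subn_gt0.
pose b j : V := (j == 0%N)%:R *: gbase 1.
have -> : gbase 1 = \sum_(j < p) b j *m N ^+ j.
  by rewrite sum1E.
move=> /stepU_coef Wb; apply: (filt_proper filtW).
have suppb j y : (j < p)%N -> y \notin M -> b j 0 (enum_rank y) = 0.
  by move=> _ yM; rewrite mxE gbM // !mulr0.
by have := Wb suppb 0%N p_gt0; rewrite mul0n subn0 /b scale1r.
Qed.

End Step.

Variable n : nat.
Hypothesis Pn : P n = 1%G.

(** Induction on the order of [M], through subgroups between consecutive terms of the series. A
    maximal subgroup of [M] that contains the lower term is normalized by [g], because commutators
    of elements of [P w1] fall into [P w1.+1]; then [step_filtered] applies. *)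
Lemma filtered_exists (M : {group gT}) w : (0 < w)%N ->
  P w.+1 \subset M -> M \subset P w -> exists W, filtered M W.
Proof.
have [c] := ubnP #|M|; elim: c => // c IH in M w *.
rewrite ltnS => Mc w_gt0 PwM MPw.
have [/eqP M1|M1] := boolP (M == 1%G).
  (* For the trivial group, level 0 is the line of [gbase 1] and all higher levels vanish. *)
  exists (fun l (v : V) => if l is 0%N then forall x, x != 1%g -> v 0 (enum_rank x) = 0 else v = 0).
  split=> /=.
  - case=> [|l] v v'; last by move=> -> ->; rewrite addr0.
    by move=> v0 v'0 x x1; rewrite mxE v0 // v'0 // addr0.
  - case=> [|l] k v; last by move=> ->; rewrite scaler0.
    by move=> v0 x x1; rewrite mxE v0 // mulr0.
  - by case=> [|l] v -> // x _; rewrite mxE.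
  - move=> l v x; rewrite M1 inE; case: l => [v0 /v0 //|l -> _].
    by rewrite mxE.
  - by move=> x x1; apply: gbase_supp; rewrite eq_sym.
  - move=> l i h v; rewrite M1 inE => /eqP-> _ _.
    rewrite gact1 subrr mulmx0; case: (l + i)%N => // x _.
    by rewrite mxE.
  - by move=> k h; rewrite M1 inE => /eqP-> _; apply: group1.
  - move=> /(congr1 (fun v : V => v 0 (enum_rank 1%g)))/eqP.
    by rewrite !mxE !eqxx oner_eq0.
have bound i : M \subset P i -> (i <= n)%N.
  move=> MPi; rewrite leqNgt; apply: contra M1 => ni.
  apply/eqP/group_inj/trivgP; apply: subset_trans MPi _.
  by rewrite -[1%g]/(gval 1%G) -Pn np_series_le // ltnW.
(* Passing to the last term [P w1] that contains [M] makes [P w1.+1] a proper subgroup of [M]. *)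
have exw : exists i, (fun i => M \subset P i) i by exists w.
case: (ex_maxnP exw bound) => w1 MPw1 w1_max.
have ww1 : (w <= w1)%N by apply: w1_max.
have PwMp : P w1.+1 \proper M.
  rewrite properE (subset_trans _ PwM) ?np_series_le //=.
  by apply/negP => /w1_max; rewrite ltnn.
have [M0 /maxgroupP[M0M M0max] PM0] := @maxgroup_exists _ (fun A => A \proper M) _ PwMp.
have [sM0M [g gM gM0]] := properP M0M.
have w1_gt0 := leq_trans w_gt0 ww1.
have M0P := subset_trans sM0M MPw1.
have gP := subsetP MPw1 _ gM.
have [W filtW] : exists W, filtered M0 W.
  by apply: (IH M0 w1) => //; apply: leq_trans Mc; apply: proper_card.
have gN : g \in 'N(M0)%g.
  apply/normP/eqP; rewrite eqEcard cardJg leqnn andbT.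
  apply/subsetP => _ /imsetP[h hM0 ->].
  have gVP : g^-1%g \in P w1 by rewrite groupV.
  have gVM : g^-1%g \notin M0 by rewrite groupV.
  by have := step_conj w1_gt0 M0P PM0 gVP gVM hM0; rewrite invgK /conjg mulgA.
have MJ : (M0 <*> <[g]>)%g = M.
  apply/eqP; rewrite eqEproper join_subG sM0M cycle_subG gM /=.
  apply/negP => Jp; case/negP: gM0.
  have := M0max [group of (M0 <*> <[g]>)%g] Jp (joing_subl _ _) => <-.
  by rewrite -cycle_subG joing_subr.
exists (stepU W w1 g p); apply: (step_filtered filtW) => // x.
rewrite -MJ norm_joinEr ?cycle_subG // => /mulsgP[m _ mM0 /cycleP[k ->] ->].
exists (m * (g ^+ p) ^+ (k %/ p))%g, (k %% p)%N; split.
- by apply: groupM => //; apply: groupX; exact: (@stepX M0 w1).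
- by rewrite ltn_mod prime_gt0.
by rewrite -expgM -mulgA -expgD mulnC -divn_eq.
Qed.

(** * Order of a subgroup generated by weighted elements *)

Section Generators.
Variables (I : finType) (s : I -> gT) (wt : I -> nat).
Hypothesis wt_gt0 : forall i, (0 < wt i)%N.
Hypothesis sP : forall i, s i \in P (wt i).

Definition word_weight (u : seq I) : nat := sumn (map wt u).

Fixpoint words k : seq (seq I) :=
  if k is k'.+1 then [seq i :: u | i <- enum I, u <- words k'] else [:: [::]].

(** Lengths below [m] are enough when all letters have positive weight, since the weight of a word
    is then at least its length. *)
Definition light_words m : seq (seq I) :=
  [seq u <- flatten [seq words k | k <- iota 0 m] | (word_weight u < m)%N].

Lemma mem_words u : u \in words (size u).
Proof.
elim: u => //= i u IH; apply/allpairsP; exists (i, u).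
by rewrite mem_enum.
Qed.

Lemma mem_light_words m u : (word_weight u < m)%N -> u \in light_words m.
Proof.
move=> um; rewrite mem_filter um; apply/flatten_mapP; exists (size u).
  rewrite mem_iota /= add0n; apply: leq_ltn_trans um.
  by elim: u => //= i u IH; rewrite /word_weight /= -add1n leq_add.
exact: mem_words.
Qed.

Fixpoint word_vec (u : seq I) : V :=
  if u is i :: u' then word_vec u' *m (gact (s i) - 1%:M) else gbase 1.

(** Modulo [W n], every element of the subgroup is a combination of products of factors [s i - 1]
    along light words. Two elements with the same coefficients differ by an element of [W n], so
    [filt_inj] and [P n = 1] make them equal; it remains to count coefficient families. *)
Theorem card_gen_le : (#|<<[set s i | i : I]>>%g| <= p ^ size (light_words n))%N.
Proof.
have sP1 i : s i \in P 1%N by apply: np_series_mem_le (sP i).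
have [W filtW] : exists W, filtered (P 1%N) W.
  by apply: (@filtered_exists _ 1); rewrite // PS.
set L := light_words n; set H := <<_>>%g.
have HP1 : H \subset P 1%N.
  by rewrite gen_subG; apply/subsetP => _ /imsetP[i _ ->].
pose comb (c : {ffun 'I_(size L) -> 'F_p}) : V :=
  \sum_i c i *: word_vec (nth [::] L i).
pose B v := exists c, W n (v - comb c).
have BD v v' : B v -> B v' -> B (v + v').
  move=> [c Wc] [c' Wc']; exists [ffun i => c i + c' i].
  rewrite (_ : _ - _ = (v - comb c) + (v' - comb c')).
    exact: (filt_add filtW).
  rewrite addrACA -opprD -big_split /=; congr (_ - _).
  by apply: eq_bigr => i _; rewrite ffunE scalerDl.
have BZ k v : B v -> B (k *: v).
  move=> [c Wc]; exists [ffun i => k * c i].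
  rewrite (_ : _ - _ = k *: (v - comb c)).
    exact: (filt_scale filtW).
  rewrite scalerBr scaler_sumr; congr (_ - _).
  by apply: eq_bigr => i _; rewrite ffunE scalerA.
have BW v : W n v -> B v.
  move=> Wv; exists [ffun=> 0]; rewrite /comb big1 ?subr0 // => i _.
  by rewrite ffunE scale0r.
have W_word u : W (word_weight u) (word_vec u).
  elim: u => [|i u IH] /=; first exact: (filt_1 filtW).
  by rewrite /word_weight /= addnC; apply: (filt_act filtW).
have B_word u : B (word_vec u).
  have [un|un] := ltnP (word_weight u) n; last first.
    by apply/BW/(filt_le filtW un).
  have uL := mem_light_words un; have uL' := uL; rewrite -index_mem in uL'.
  exists [ffun i => (i == Ordinal uL')%:R].
  rewrite /comb (bigD1 (Ordinal uL')) //= ffunE eqxx scale1r nth_index //.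
  rewrite big1 => [|i /negbTE ni]; last by rewrite ffunE ni scale0r.
  by rewrite addr0 subrr; apply: filt0 filtW _.
(* Prefixing a letter to a light word gives a light word or a vector of [W n], so the span [B] is
   stable under the generators. *)
have Bs v i : B v -> B (v *m gact (s i)).
  move=> Bv; rewrite -[gact _](subrK 1%:M) mulmxDr mulmx1; apply: (BD) => //.
  have [c Wc] := Bv; rewrite -[v](subrK (comb c)) mulmxDl; apply: (BD).
    by apply: BW; apply: (filt_le filtW (leq_addr (wt i) n)); apply: (filt_act filtW).
  rewrite mulmx_suml; elim/big_ind: _ => [|a b|j _].
  - by apply: BW; apply: filt0 filtW _.
  - exact: BD.
  by rewrite -scalemxAl; apply: BZ; apply: (B_word (i :: nth [::] L j)).
have BH h : exists c, h \in H -> W n (gbase h - comb c).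
  have [hH|hH] := boolP (h \in H); last by exists [ffun=> 0].
  suff [c Wc] : B (gbase h) by exists c.
  have /gen_prodgP[k [f fS ->]] := hH.
  elim: k f fS {h hH} => [|k IH] f fS; first by rewrite big_ord0; apply: (B_word [::]).
  rewrite big_ord_recr /= -gbase_act; have /imsetP[i _ ->] := fS ord_max.
  by apply/Bs/IH => j; apply: fS.
have [c Wc] := choice BH.
rewrite -[X in (_ <= X ^ _)%N](card_Fp p_pr) -[size L]card_ord -card_ffun.
rewrite -(card_in_imset (f := c) (D := mem H)) ?max_card // => h h' hH h'H E.
have h'1 := subsetP HP1 _ h'H; have h1 := subsetP HP1 _ hH.
have W1 : W n (gbase h - gbase h').
  rewrite (_ : _ - _ = (gbase h - comb (c h)) + (-1) *: (gbase h' - comb (c h'))).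
    by apply: (filt_add filtW); [|apply: (filt_scale filtW)]; apply: Wc.
  by rewrite scaleN1r E opprB addrA subrK.
have : W n ((gbase h - gbase h') *m gact h'^-1).
  rewrite -[gact _](subrK 1%:M) mulmxDr mulmx1; apply: (filt_add filtW) => //.
  rewrite -[n]addn0; apply: (filt_act filtW); rewrite ?groupV //.
  exact: np_series_mem_le h'1.
rewrite mulmxBl !gbase_act mulgV => /(filt_inj filtW).
rewrite groupM ?groupV // Pn inE => /(_ isT) /eqP E1.
by apply: (mulIg h'^-1%g); rewrite E1 mulgV.
Qed.
End Generators.
End Jennings.

(** * Lower bound from truncated free algebras *)

Lemma exprBn1_prime_pow (R : pzRingType) (p e : nat) (x : R) :
  prime p -> p%:R = 0 :> R -> (x - 1) ^+ (p ^ e) = x ^+ (p ^ e) - 1.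
Proof.
move=> p_pr p0; elim: e => [|e IH]; first by rewrite !expr1.
by rewrite expnSr !exprM IH exprBn1_prime.
Qed.

Lemma pgroup_exponent (gT : finGroupType) (G : {group gT}) (p k : nat) :
  prime p -> (forall x, x \in G -> x ^+ (p ^ k) = 1)%g -> (p.-group G)%g.
Proof.
move=> p_pr expG; apply/pgroupP => q q_pr /(Cauchy q_pr)[x xG xq].
have : (q %| p ^ k)%N by rewrite -xq order_dvdn expG.
by rewrite Euclid_dvdX // dvdn_prime2 // => /andP[/eqP-> _]; rewrite inE.
Qed.

(** Here [[~ g, h] = (h * g)^-1 * (g * h)], and the ring commutator of [g] and [h] does not change
    when 1 is subtracted from both. *)
Lemma val_unit_commg (R : finUnitRingType) (g h : {unit R}) :
  FinRing.uval [~ g, h]%g - 1 = FinRing.uval (h * g)^-1%g *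
   ((FinRing.uval g - 1) * (FinRing.uval h - 1) - (FinRing.uval h - 1) * (FinRing.uval g - 1)).
Proof.
set a := FinRing.uval g; set b := FinRing.uval h.
have -> : (a - 1) * (b - 1) - (b - 1) * (a - 1) = a * b - b * a.
  rewrite !mulrBl !mulrBr !mul1r !mulr1.
  rewrite -[_ - a - _]addrA -opprD -[_ - b - _]addrA -opprD [b + (a - 1)]addrCA.
  by move: (a + _) => S; rewrite opprB addrA subrK.
rewrite mulrBr; congr (_ - _).
  by rewrite -[RHS]/(FinRing.uval ((h * g)^-1 * (g * h))%g) commgEl /conjg invMg !mulgA.
by rewrite -[RHS]/(FinRing.uval ((h * g)^-1 * (h * g))%g) mulVg.
Qed.

(** * Congruence subgroups of a graded matrix algebra *)

Section GradedMatrices.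
Variables (p K n : nat) (gr : 'I_K.+1 -> nat).
Hypothesis p_pr : prime p.
Hypothesis grade_lt : forall r, (gr r < n)%N.
Notation MM := 'M['F_p]_K.+1.

Definition degree_ge (i : nat) (M : MM) :=
  [forall r, forall c, (M r c != 0) ==> (gr r + i <= gr c)%N].

Lemma degree_geP i (M : MM) :
  reflect (forall r c, M r c != 0 -> (gr r + i <= gr c)%N) (degree_ge i M).
Proof.
apply: (iffP forallP) => [H r c|H r]; first by move/forallP: (H r) => /(_ c)/implyP.
by apply/forallP => c; apply/implyP/H.
Qed.

Lemma degree_geD i M M' : degree_ge i M -> degree_ge i M' -> degree_ge i (M + M').
Proof.
move=> /degree_geP h /degree_geP h'; apply/degree_geP => r c; rewrite mxE.
have [->|m _] := eqVneq (M r c) 0; last exact: h.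
by rewrite add0r; apply: h'.
Qed.

Lemma degree_geN i M : degree_ge i M -> degree_ge i (- M).
Proof.
by move=> /degree_geP h; apply/degree_geP => r c; rewrite mxE oppr_eq0; apply: h.
Qed.

Lemma degree_geB i M M' : degree_ge i M -> degree_ge i M' -> degree_ge i (M - M').
Proof. by move=> ? ?; apply: degree_geD => //; apply: degree_geN. Qed.

Lemma degree_geM i j M M' : degree_ge i M -> degree_ge j M' -> degree_ge (i + j) (M * M').
Proof.
move=> /degree_geP h /degree_geP h'; apply/degree_geP => r c.
rewrite -mulmxE mxE => nz; have [k _ nzk] : exists2 k, true & M r k * M' k c != 0.
  apply/exists_inP; apply: contraNT nz; rewrite negb_exists => /forallP h0.
  by rewrite big1 // => k _; apply/eqP; have := h0 k; rewrite negbK.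
move: nzk; rewrite mulf_eq0 negb_or => /andP[/h a /h' b].
by apply: leq_trans b; rewrite addnA leq_add2r.
Qed.

Lemma degree_ge_le i j M : (i <= j)%N -> degree_ge j M -> degree_ge i M.
Proof.
move=> ij /degree_geP h; apply/degree_geP => r c /h.
by apply: leq_trans; rewrite leq_add2l.
Qed.

Lemma degree_ge0 i : degree_ge i 0.
Proof. by apply/degree_geP => r c; rewrite mxE eqxx. Qed.

Lemma degree_ge_1 : degree_ge 0 1.
Proof.
apply/degree_geP => r c; rewrite mxE; have [->|_] := eqVneq r c; first by rewrite addn0.
by rewrite eqxx.
Qed.

Lemma degree_ge_n i M : (n <= i)%N -> degree_ge i M -> M = 0.
Proof.
move=> ni /degree_geP h; apply/matrixP => r c; rewrite mxE; apply/eqP/negPn/negP => /h.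
move/(leq_trans (leq_trans (grade_lt c) (leq_trans ni (leq_addl (gr r) i)))).
by rewrite ltnn.
Qed.

Lemma degree_geX i k M : degree_ge i M -> degree_ge (k * i) (M ^+ k).
Proof.
move=> h; elim: k => [|k IH]; first exact: degree_ge_1.
by rewrite mulSn exprS degree_geM.
Qed.

Lemma mx_pchar0 : p%:R = 0 :> MM.
Proof. by rewrite -[1]/(1%:M) -raddfMn /= (pcharf0 (pchar_Fp p_pr)) raddf0. Qed.

Notation UU := {unit 'M['F_p]_K.+1}.
Notation uv := (FinRing.uval).

Definition congruence_set (i : nat) : {set UU} := [set u : UU | degree_ge i (uv u - 1)].

Lemma congruence_group_set i : group_set (congruence_set i).
Proof.
apply/group_setP; split; first by rewrite inE subrr degree_ge0.
move=> g h; rewrite !inE => dg dh.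
rewrite (_ : _ - 1 = (uv g - 1) * (uv h - 1) + ((uv g - 1) + (uv h - 1))).
  apply: degree_geD; last exact: degree_geD.
  by apply: (degree_ge_le (leq_addr i i)); apply: degree_geM.
by rewrite mulrBl mulrBr !mul1r mulr1 addrACA addNr addr0 addrA subrK.
Qed.

Definition congruence (i : nat) : {group UU} := Group (congruence_group_set i).

Lemma congruenceE i u : (u \in congruence i) = degree_ge i (uv u - 1).
Proof. by rewrite inE. Qed.

Lemma congruence_val0 i u : u \in congruence i -> degree_ge 0 (uv u).
Proof.
rewrite congruenceE => /(degree_ge_le (leq0n _)) h.
by rewrite -[uv u](subrK 1); apply: degree_geD => //; apply: degree_ge_1.
Qed.

Lemma congruence_S i : congruence i.+1 \subset congruence i.
Proof.
by apply/subsetP => u; rewrite !congruenceE; apply: degree_ge_le.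
Qed.

Lemma congruence_comm i j g h : g \in congruence i -> h \in congruence j ->
  [~ g, h]%g \in congruence (i + j).
Proof.
move=> gi hj; have gi' := gi; have hj' := hj; rewrite !congruenceE in gi hj *.
have ghV : (h * g)^-1%g \in congruence 0.
  by rewrite groupV groupM // congruenceE; [move: hj | move: gi]; apply: degree_ge_le.
rewrite val_unit_commg -[(i + j)%N]add0n; apply: degree_geM.
  exact: congruence_val0 ghV.
by apply: degree_geB; [|rewrite addnC]; apply: degree_geM.
Qed.

(** The factor [(h * g)^-1] is 1 modulo degree 1, and [g - 1] is [M] modulo degree [m + 1]; so the
    leading term of the group commutator is the ring commutator of the leading terms. *)
Lemma congruence_commg_lead m (g h : UU) (M N : MM) :
  (0 < m)%N -> g \in congruence m -> h \in congruence 1 ->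
  degree_ge m.+1 (uv g - 1 - M) -> uv h - 1 = N ->
  degree_ge m.+2 (uv [~ g, h]%g - 1 - (M * N - N * M)).
Proof.
move=> m_gt0 gm h1 gM hN.
have ghV : (h * g)^-1%g \in congruence 1.
  rewrite groupV groupM //; move: gm; rewrite !congruenceE.
  exact: degree_ge_le.
have N_deg : degree_ge 1 N by rewrite -hN -congruenceE.
rewrite val_unit_commg hN.
have a_deg : degree_ge m (uv g - 1) by rewrite -congruenceE.
move: (uv g - 1) a_deg gM => a a_deg gM.
have aN_deg : degree_ge m.+1 (a * N - N * a).
  by apply: degree_geB; rewrite -addn1; [|rewrite addnC]; apply: degree_geM.
have u_deg : degree_ge 1 (uv (h * g)^-1%g - 1) by rewrite -congruenceE.
move: (uv _) u_deg => u u_deg.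
have -> : u * (a * N - N * a) - (M * N - N * M) =
    (u - 1) * (a * N - N * a) + ((a - M) * N - N * (a - M)).
  rewrite mulrBl mul1r [(a - _) * N]mulrBl [N * (a - _)]mulrBr.
  have -> : a * N - M * N - (N * a - N * M) = a * N - N * a - (M * N - N * M).
    by rewrite !opprD !opprK addrACA.
  by rewrite addrA subrK.
apply: degree_geD; first exact: (degree_geM u_deg aN_deg).
by apply: degree_geB; rewrite -[m.+2]addn1; [|rewrite addnC]; apply: degree_geM.
Qed.

Lemma congruence_exp i g : g \in congruence i -> (g ^+ p)%g \in congruence (p * i).
Proof.
rewrite !congruenceE FinRing.val_unitX -exprBn1_prime ?mx_pchar0 //.
exact: degree_geX.
Qed.

Lemma congruence_n i : (n <= i)%N -> congruence i = 1%G.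
Proof.
move=> ni; apply/group_inj/setP => u; rewrite congruenceE inE.
apply/idP/eqP => [/(degree_ge_n ni)/eqP|->]; last by rewrite subrr degree_ge0.
by rewrite subr_eq0 => /eqP E; apply: val_inj.
Qed.

Lemma congruence_pgroup : (p.-group (congruence 1))%g.
Proof.
apply: (@pgroup_exponent _ _ p n p_pr) => u u1.
have u_pow k : (u ^+ (p ^ k))%g \in congruence (p ^ k).
  elim: k => [|k IH]; first by rewrite expg1.
  by rewrite expnSr expgM mulnC congruence_exp.
have := u_pow n; rewrite congruence_n ?inE; first by move/eqP.
by apply: ltnW; apply: ltn_expl; apply: prime_gt1.
Qed.

End GradedMatrices.

(** * The truncated free associative algebra *)

Section WordMatrices.
Variables (p : nat) (A : finType) (x y : A) (Q e l : nat).
Hypothesis p_pr : prime p.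
Hypothesis qE : Q.+1 = (p ^ e)%N.
Hypothesis yx : y != x.

(* Words with no factor x^(Q+1), with at most k leading letters x. *)
Fixpoint run_free k (w : seq A) : bool :=
  if w is c :: w' then
    if c == x then (if k is k'.+1 then run_free k' w' else false) else run_free Q w'
  else true.

Lemma run_freeS k w : run_free k w -> run_free k.+1 w.
Proof.
elim: w k => //= c w IH k; case: ifP => // _.
by case: k => // k; apply: IH.
Qed.

Lemma run_free_behead c w : run_free Q (c :: w) -> run_free Q w.
Proof.
suff H k : (k <= Q)%N -> run_free k (c :: w) -> run_free Q w by apply: H.
move=> kQ /=; case: ifP => // _; case: k kQ => // k /ltnW/subnK <-.
by elim: (Q - k)%N => // j IH /IH; rewrite addSn; apply: run_freeS.
Qed.

Lemma run_free_belast k w c : run_free k (rcons w c) -> run_free k w.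
Proof.
elim: w k => //= d w IH k; case: ifP => _; last exact: IH.
by case: k => // k; apply: IH.
Qed.

Lemma run_free_nseq k : ~~ run_free k (nseq k.+1 x).
have E k' w : run_free k'.+1 (x :: w) = run_free k' w by rewrite /= eqxx.
by elim: k => [|k IH]; [rewrite /= eqxx | rewrite -[nseq _ _]/(x :: nseq k.+1 x) E].
Qed.

(** Not ending in [x] ensures that appending [x ^ Q] creates no factor [x ^ (Q + 1)]. The default
    [y] of [last] makes the empty word admissible. *)
Definition admissible (t : seq A) := run_free Q t && (last y t != x).

Lemma admissible_behead c t : admissible (c :: t) -> admissible t.
Proof.
rewrite /admissible => /andP[/run_free_behead -> /=].
by case: t.
Qed.

Lemma admissible_cat t : admissible t -> run_free Q (t ++ nseq Q x).
Proof.
(* When [t] is exhausted, the whole allowance [Q] has to be available: this holds at the start and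
   after a letter other than [x]. *)
suff H : forall k, run_free k t -> last y t != x -> (t == [::] -> k = Q) ->
    run_free k (t ++ nseq Q x).
  by move=> /andP[t1 t2]; apply: H.
elim: t => [|c t IH] k /=.
  move=> _ _ /(_ isT) ->; elim: Q => //= k' IH'.
  by rewrite eqxx.
case: ifP => [/eqP ->|_].
  case: k => // k tk tx _; apply: IH => //.
    by case: t {tk} tx => //=; rewrite eqxx.
  by case: t {tk} tx => //=; rewrite eqxx.
by move=> tk tx _; apply: IH => //; case: t {tk} tx.
Qed.

Notation n := (Q.+1 + l).+1.
Notation T := ((Q.+1 + l).-bseq A).
Notation K := #|{: T}|.-1.
Notation MM := 'M['F_p]_K.+1.

Definition word (r : 'I_K.+1) : seq A := nth [bseq] (enum {: T}) r.
Definition word_index (w : T) : 'I_K.+1 := inord (index w (enum {: T})).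

Lemma card_word_index : K.+1 = #|{: T}|.
Proof. by rewrite prednK //; apply/card_gt0P; exists [bseq]. Qed.

Lemma word_indexK w : word (word_index w) = w.
Proof.
have wT : (index w (enum {: T}) < size (enum {: T}))%N by rewrite index_mem mem_enum.
by rewrite /word inordK ?nth_index ?mem_enum // card_word_index cardE.
Qed.

Lemma word_inj : injective word.
Proof.
have lt (r : 'I_K.+1) : (r < size (enum {: T}))%N.
  by rewrite -cardE; apply: leq_trans (ltn_ord r) _; rewrite card_word_index.
move=> r r' /val_inj/eqP; rewrite nth_uniq ?enum_uniq //.
by move/eqP/val_inj.
Qed.

Lemma word_ex w : (size w <= Q.+1 + l)%N -> exists r, word r = w.
Proof. by move=> sw; exists (word_index (Bseq sw)); rewrite word_indexK. Qed.

Lemma size_word r : (size (word r) <= Q.+1 + l)%N.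
Proof. by rewrite /word; case: (nth _ _ _). Qed.

(** Right multiplication by [c] on the span of the words, where words longer than [Q + 1 + l] are
    dropped. With row vectors, matrix products multiply words in the order in which they are
    written. *)
Definition letter_mx (c : A) : MM := \matrix_(r, r') (word r' == rcons (word r) c)%:R.

Lemma mul_letter_mx (M : MM) c r r' v : word r' = rcons (word v) c ->
  (M * letter_mx c) r r' = M r v.
Proof.
move=> E; rewrite -mulmxE mxE (bigD1 v) //= mxE E eqxx mulr1 big1 ?addr0 // => k kv.
rewrite mxE E eqseq_rcons eqxx andbT; case: eqP => [/word_inj E'|]; rewrite ?mulr0 //.
by rewrite E' eqxx in kv.
Qed.

Lemma mul_letter_mx0 (M : MM) c r r' : (forall v, word r' <> rcons (word v) c) ->
  (M * letter_mx c) r r' = 0.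
Proof.
move=> E; rewrite -mulmxE mxE big1 // => k _.
by rewrite mxE; case: eqP => [/E|]; rewrite ?mulr0.
Qed.

Lemma letter_mx_mul (M : MM) c r r' v : word v = rcons (word r) c ->
  (letter_mx c * M) r r' = M v r'.
Proof.
move=> E; rewrite -mulmxE mxE (bigD1 v) //= mxE E eqxx mul1r big1 ?addr0 // => k kv.
rewrite mxE -E; case: eqP => [/word_inj E'|]; rewrite ?mul0r //.
by rewrite E' eqxx in kv.
Qed.

Lemma letter_mx_mul0 (M : MM) c r r' : (forall v, word v <> rcons (word r) c) ->
  (letter_mx c * M) r r' = 0.
Proof.
move=> E; rewrite -mulmxE mxE big1 // => k _.
by rewrite mxE; case: eqP => [/E|]; rewrite ?mul0r.
Qed.

Lemma letter_mxX c k r r' : (letter_mx c ^+ k) r r' = (word r' == word r ++ nseq k c)%:R.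
Proof.
elim: k r' => [|k IH] r'; first by rewrite expr0 mxE cats0 eq_sym (inj_eq word_inj).
rewrite exprSr; have [[v E]|E] := pselect (exists v, word r' = rcons (word v) c).
  rewrite (mul_letter_mx _ _ E) IH E -addn1 nseqD cats1 -rcons_cat.
  by rewrite eqseq_rcons eqxx andbT.
rewrite mul_letter_mx0 => [|v Ev]; last by apply: E; exists v.
case: eqP => // E'; case: E; have := size_word r'.
rewrite E' -addn1 nseqD catA cats1 size_rcons => /ltnW/word_ex[v Ev].
by exists v; rewrite Ev.
Qed.

(** [foldr] brackets with the first letter of [s] last, so that the product with all letters on the
    left reads [s] followed by [x ^ (Q + 1)]. *)
Definition lie_mx (s : seq A) : MM :=
  foldr (fun c M => M * letter_mx c - letter_mx c * M) (letter_mx x ^+ Q.+1) s.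

(** Each bracket attaches a letter to one end of the monomials, so the initial factor [x ^ (Q + 1)]
    is never broken. *)
Lemma lie_mx_support s r r' : lie_mx s r r' != 0 ->
  exists2 w, word r' = word r ++ w & ~~ run_free Q w.
Proof.
elim: s r r' => [|c s IH] r r' /=.
  rewrite letter_mxX; case: (word r' =P _) => [E _|_]; last by rewrite eqxx.
  by exists (nseq Q.+1 x) => //; apply: run_free_nseq.
rewrite mxE [X in _ + X]mxE => nz.
have [z1|nz1] := eqVneq ((lie_mx s * letter_mx c) r r') 0; last first.
  have [[v E]|E] := pselect (exists v, word r' = rcons (word v) c); last first.
    by rewrite mul_letter_mx0 ?eqxx // in nz1 => v Ev; apply: E; exists v.
  move: nz1; rewrite (mul_letter_mx _ _ E) => /IH[w Ew wf].
  exists (rcons w c); first by rewrite E Ew rcons_cat.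
  by apply: contra wf; apply: run_free_belast.
move: nz; rewrite z1 add0r oppr_eq0 => nz2.
have [[v E]|E] := pselect (exists v, word v = rcons (word r) c); last first.
  by rewrite letter_mx_mul0 ?eqxx // in nz2 => v Ev; apply: E; exists v.
move: nz2; rewrite (letter_mx_mul _ _ E) => /IH[w Ew wf].
exists (c :: w); first by rewrite Ew E cat_rcons.
by apply: contra wf; apply: run_free_behead.
Qed.

(* A monomial of [lie_mx s] ending in x^(Q+1) without earlier occurrence of that
   factor can only come from the terms with all letters to the left. *)
Lemma lie_mx_coef s t r r' : size s = size t -> admissible t ->
  word r' = word r ++ t ++ nseq Q.+1 x ->
  lie_mx s r r' = (-1) ^+ size t * (s == t)%:R.
Proof.
elim: s t r r' => [|c s IH] [|d t] //= r r'.
  by move=> _ _ E; rewrite letter_mxX E eqxx expr0 mulr1.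
move=> [st] ad E; have adt := admissible_behead ad.
(* If [c] stood on the right, the factor [x ^ (Q + 1)] would lie in [d :: t] followed by [x ^ Q],
   against [admissible_cat]. *)
have z1 : (lie_mx s * letter_mx c) r r' = 0.
  apply/eqP/negPn/negP => nz.
  have [[v Ev]|Ev] := pselect (exists v, word r' = rcons (word v) c); last first.
    by rewrite mul_letter_mx0 ?eqxx // in nz => v Ev'; apply: Ev; exists v.
  move: nz; rewrite (mul_letter_mx _ _ Ev) => /lie_mx_support[w Ew wf].
  have xE : x :: nseq Q x = rcons (nseq Q x) x.
    by elim: (Q) => //= k Ek; rewrite {1}Ek.
  move: Ev; rewrite E Ew xE -rcons_cat -rcons_cons -rcons_cat => /eqP.
  rewrite eqseq_rcons => /andP[+ _]; rewrite eqseq_cat // eqxx /= => /eqP E'.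
  by case/negP: wf; rewrite -E'; apply: (admissible_cat ad).
rewrite mxE z1 add0r mxE exprS mulN1r mulNr eqseq_cons; congr (- _).
have [v Ev] : exists v, word v = rcons (word r) c.
  by apply: word_ex; have := size_word r'; rewrite E size_rcons !size_cat /=; lia.
rewrite (letter_mx_mul _ _ Ev); have [cd|cd] := eqVneq c d.
  by rewrite (IH t) // Ev E cd cat_rcons.
rewrite mulr0; apply/eqP/negPn/negP => /lie_mx_support[w Ew _].
move: Ew; rewrite E Ev cat_rcons => /eqP; rewrite eqseq_cat // eqxx /= eqseq_cons.
by rewrite eq_sym (negbTE cd).
Qed.

Notation gr := (fun r => size (word r)).
Notation UU := {unit 'M['F_p]_K.+1}.
Notation uv := (FinRing.uval).
Notation deg := (degree_ge gr).

Lemma grade_lt r : (gr r < n)%N. Proof. exact: size_word. Qed.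

Lemma letter_mx_deg c : deg 1 (letter_mx c).
Proof.
apply/degree_geP => r r'; rewrite mxE; case: (word r' =P _) => [->|]; last by rewrite eqxx.
by rewrite size_rcons addn1.
Qed.

(** In characteristic p, [(1 + X) ^ (p ^ n) = 1 + X ^ (p ^ n)], and the last power vanishes for
    reasons of degree. *)
Lemma letter_unit c : 1 + letter_mx c \is a GRing.unit.
Proof.
have n_gt0 : (0 < p ^ n)%N by rewrite expn_gt0 prime_gt0.
rewrite -(unitrX_pos _ n_gt0).
suff -> : (1 + letter_mx c) ^+ (p ^ n) = 1 by exact: unitr1.
have := exprBn1_prime_pow n (1 + letter_mx c) p_pr (mx_pchar0 _ p_pr).
rewrite addrAC subrr add0r (@degree_ge_n _ _ n gr grade_lt (p ^ n) (letter_mx c ^+ _)).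
- by move/esym/eqP; rewrite subr_eq0 => /eqP.
- by apply/ltnW/ltn_expl/prime_gt1.
by have := degree_geX (p ^ n) (letter_mx_deg c); rewrite muln1.
Qed.

Definition letter_elt (c : A) : UU := FinRing.Unit (letter_unit c).

Lemma letter_elt1 c : letter_elt c \in congruence p gr 1.
Proof. by rewrite congruenceE /= addrAC subrr add0r letter_mx_deg. Qed.

Definition lie_elt (s : seq A) : UU :=
  foldr (fun c g => [~ g, letter_elt c]%g) (letter_elt x ^+ Q.+1)%g s.

(** The start is exact: [(1 + X) ^ (Q + 1) - 1 = X ^ (Q + 1)], because [Q + 1] is a power of p. Each
    commutator then raises the degree by one and brackets the leading term, by
    [congruence_commg_lead]. *)
Lemma lie_elt_deg s : lie_elt s \in congruence p gr (Q.+1 + size s) /\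
  deg (Q.+1 + size s).+1 (uv (lie_elt s) - 1 - lie_mx s).
Proof.
elim: s => [|c s [IH1 IH2]] /=.
  have E : uv (letter_elt x ^+ Q.+1)%g - 1 = letter_mx x ^+ Q.+1.
    have pw := exprBn1_prime_pow e (uv (letter_elt x)) p_pr (mx_pchar0 _ p_pr).
    by rewrite -qE in pw; rewrite FinRing.val_unitX -pw /= addrAC subrr add0r.
  rewrite congruenceE E addn0 subrr degree_ge0; split=> //.
  by have := degree_geX Q.+1 (letter_mx_deg x); rewrite muln1.
have g1 := letter_elt1 c; have g0 : letter_elt c \in congruence p gr 0.
  exact: (subsetP (congruence_S _ _ _)).
have mS : (Q.+1 + (size s).+1 = (Q.+1 + size s) + 1)%N by rewrite addn1 addnS.
split; first by rewrite mS; apply: congruence_comm.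
have m_gt0 : (0 < Q.+1 + size s)%N by [].
have hE : uv (letter_elt c) - 1 = letter_mx c by rewrite /= addrAC subrr add0r.
rewrite (_ : (Q.+1 + (size s).+1).+1 = (Q.+1 + size s).+2)%N; last by rewrite addnS.
exact: congruence_commg_lead m_gt0 IH1 g1 IH2 hE.
Qed.

(** For words of length [l] the commutators have the highest nonzero degree, so [lie_elt t] equals
    [1 + lie_mx t] and products of two such [lie_mx] vanish. Multiplication thus becomes addition,
    and the coefficients of the monomials [t x ^ (Q + 1)] tell the products apart. *)
Lemma admissible_basis (S : seq (seq A)) : uniq S ->
  (forall t, t \in S -> admissible t /\ size t = l) ->
  (p ^ size S <= #|<<[set letter_elt c | c : A]>>%g|)%N.
Proof.
move=> uniqS admS; set Gam := <<_>>%g.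
pose G (i : 'I_(size S)) := lie_elt (nth [::] S i).
pose Pm (i : 'I_(size S)) := lie_mx (nth [::] S i).
have S_i (i : 'I_(size S)) : nth [::] S i \in S by rewrite mem_nth.
have sz i : size (nth [::] S (i : 'I_(size S))) = l by case: (admS _ (S_i i)).
have G_in i : G i \in Gam.
  rewrite /G; elim: (nth _ _ _) => [|c s IH] /=.
    by rewrite groupX // mem_gen // imset_f.
  by rewrite groupR // mem_gen // imset_f.
have GE i : uv (G i) = 1 + Pm i.
  have [_] := lie_elt_deg (nth [::] S i); rewrite sz => /(degree_ge_n grade_lt (leqnn _))/eqP.
  by rewrite subr_eq0 /Pm => /eqP <-; rewrite addrC subrK.
have PmM i j : Pm i * Pm j = 0.
  apply: (@degree_ge_n _ _ n gr grade_lt (Q.+1 + l + (Q.+1 + l))); first by lia.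
  have Pd k : deg (Q.+1 + l) (Pm k).
    have [+ _] := lie_elt_deg (nth [::] S k).
    by rewrite congruenceE sz GE addrAC subrr add0r.
  exact: degree_geM.
pose prodG (c : {ffun 'I_(size S) -> 'F_p}) := (\prod_i G i ^+ c i)%g.
have GX i k : uv (G i ^+ k)%g = 1 + Pm i *+ k.
  elim: k => [|k IH]; first by rewrite addr0.
  rewrite expgS -[uv _]/(uv (G i) * uv (G i ^+ k)%g) IH GE mulrDl mul1r mulrDr mulr1.
  by rewrite mulrnAr PmM mul0rn addr0 mulrSr -addrA.
have prodGE c : uv (prodG c) = 1 + \sum_i Pm i *+ c i.
  rewrite /prodG.
  have [_ //] : (forall i, Pm i * \sum_(i <- index_enum 'I_(size S)) Pm i *+ c i = 0) /\
      uv (\prod_(i <- index_enum 'I_(size S)) G i ^+ c i)%g =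
      1 + \sum_(i <- index_enum 'I_(size S)) Pm i *+ c i.
  elim: (index_enum _) => [|i s [IH1 IH2]].
    by rewrite !big_nil addr0; split=> // i; rewrite mulr0.
  rewrite !big_cons; split=> [j|].
    by rewrite mulrDr IH1 mulrnAr PmM mul0rn addr0.
  rewrite -[uv _]/(uv (G i ^+ c i)%g * uv (\prod_(j <- s) G j ^+ c j)%g) IH2 GX.
  by rewrite mulrDl mul1r mulrDr mulr1 mulrnAl IH1 mul0rn addr0 addrAC addrA.
have prodG_inj : injective prodG.
  move=> c c' E; apply/ffunP => i.
  have Ei := congr1 uv E; rewrite !prodGE in Ei; move/addrI: Ei => Ei.
  have [ad st] := admS _ (S_i i); set t := nth [::] S i in ad st.
  (* The row of the empty word and the column of [t x ^ (Q + 1)] isolate the exponent with index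
     [i], up to sign. *)
  have [r0 r0E] : exists r, word r = [::] by apply: word_ex.
  have [r1 r1E] : exists r, word r = t ++ nseq Q.+1 x.
    by apply: word_ex; rewrite size_cat size_nseq st addnC.
  have coefE (d : {ffun 'I_(size S) -> 'F_p}) :
      (\sum_j Pm j *+ d j) r0 r1 = (-1) ^+ l * d i.
    rewrite summxE (bigD1 i) //= big1 => [|j ji].
      rewrite mulmxnE /Pm (@lie_mx_coef _ t) ?r0E // eqxx mulr1 addr0 st.
      by rewrite -mulr_natr natr_Zp.
    rewrite mulmxnE /Pm (@lie_mx_coef _ t) ?r0E ?sz //.
    by rewrite nth_uniq // (negbTE (ji : (j : nat) != i)) mulr0 mul0rn.
  have := congr1 (fun M : MM => M r0 r1) Ei; rewrite !coefE.
  by apply: mulfI; rewrite expf_eq0 oppr_eq0 oner_eq0 andbF.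
rewrite -[X in (X ^ _ <= _)%N](card_Fp p_pr) -[size S]card_ord -card_ffun.
apply: leq_trans (_ : #|prodG @: setT| <= _)%N.
  by rewrite (card_imset _ prodG_inj) cardsT.
apply/subset_leq_card/subsetP => _ /imsetP[c _ ->].
by apply: group_prod => i _; rewrite groupX.
Qed.
End WordMatrices.

(** Appending [y] makes each run-free word of length [l] admissible; hence the parameter [l + 1] in
    the truncation and the vanishing of [P] at [Q + 3 + l]. *)
Theorem large_np_quotient (p : nat) (A : finType) (x y : A) (Q e l : nat) :
  prime p -> Q.+1 = (p ^ e)%N -> y != x ->
  exists (gT : finGroupType) (P : nat -> {group gT}) (f : A -> gT),
  [/\ np_series p P, P (Q.+3 + l)%N = 1%G, (p.-group (P 1%N))%g,
      forall c, f c \in P 1%N &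
      (p ^ count (run_free x Q Q) (words A l) <= #|<<[set f c | c : A]>>%g|)%N].
Proof.
move=> p_pr qE yx; pose gr := fun r => size (@word A Q l.+1 r).
exists {unit 'M['F_p]_#|{: (Q.+1 + l.+1).-bseq A}|.-1.+1}, (congruence p gr).
exists (letter_elt Q l.+1 p_pr); split.
- split; first exact: congruence_S.
  + exact: congruence_comm.
  + exact: congruence_exp.
- by apply: (congruence_n p (@grade_lt A Q l.+1)); rewrite addnS.
- exact: (congruence_pgroup p_pr (@grade_lt A Q l.+1)).
- exact: letter_elt1.
pose S := [seq rcons w y | w <- [seq w <- words A l | run_free x Q Q w]].
have <- : size S = count (run_free x Q Q) (words A l) by rewrite size_map size_filter.
apply: (admissible_basis p_pr qE yx).
  rewrite map_inj_uniq => [|w w' /rcons_inj[]//]; apply: filter_uniq.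
  elim: l {S gr} => //= l' IH; apply: allpairs_uniq => //; first exact: enum_uniq.
  by move=> [? ?] [? ?] _ _ [-> ->].
move=> _ /mapP[w + ->]; rewrite mem_filter => /andP[wf wl]; split; last first.
  rewrite size_rcons; congr _.+1.
  elim: l w wl {wf S gr} => [|l' IH] w /=; first by rewrite inE => /eqP->.
  by case/allpairsP => -[i u] [_ /= /IH <- ->].
rewrite /admissible last_rcons yx andbT.
suff H k : run_free x Q k w -> run_free x Q k (rcons w y) by apply: H.
elim: w k {wf wl} => [|c w IH] k /=; first by rewrite (negbTE yx).
by case: ifP => _; [case: k => // k|]; apply: IH.
Qed.

(** * Comparison of word counts *)

Section WordCounts.
Variable R : archiRealFieldType.

(** The quadratic term lets a geometric sequence dominate a linear one in [natr_expr_eventually]. *)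
Lemma bernoulli2 (h : R) n : 0 <= h -> 1 + n%:R * h + 'C(n, 2)%:R * h ^+ 2 <= (1 + h) ^+ n.
Proof.
move=> h0; elim: n => [|n IH]; first by rewrite mul0r bin0n mul0r !addr0 expr0.
have h2 := exprn_ge0 2 h0; have h3 := exprn_ge0 3 h0.
have c0 : 0 <= 'C(n, 2)%:R :> R by [].
rewrite [X in _ <= X]exprS binS bin1 natrD -natr1.
set c := 'C(n, 2)%:R in IH c0 *; set x := n%:R in IH *.
have := ler_wpM2l (_ : 0 <= 1 + h) IH; rewrite addr_ge0 // => /(_ isT) H.
apply: le_trans H; have := mulr_ge0 c0 h3; lra.
Qed.

Lemma expr_eventually_ge (r B : R) : 1 < r -> exists N, forall n, (N <= n)%N -> B <= r ^+ n.
Proof.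
move=> r1; have h0 : 0 < r - 1 by rewrite subr_gt0.
exists (Num.bound (`|B| / (r - 1))) => n Nn.
have := bernoulli2 n (ltW h0); rewrite [1 + (r - 1)]addrC subrK => H.
apply: le_trans H; have c0 : 0 <= 'C(n, 2)%:R * (r - 1) ^+ 2 by rewrite mulr_ge0 ?exprn_ge0 // ltW.
have : `|B| / (r - 1) <= n%:R.
  apply: le_trans (_ : (Num.bound (`|B| / (r - 1)))%:R <= _); last by rewrite ler_nat.
  by apply/ltW/archi_boundP; rewrite divr_ge0 // ltW.
rewrite ler_pdivrMr // => Bn; have := ler_norm B; lra.
Qed.

Lemma natr_expr_eventually (r B : R) : 1 < r ->
  exists N, forall n, (N <= n)%N -> B * n%:R <= r ^+ n.
Proof.
move=> r1; have h0 : 0 < r - 1 by rewrite subr_gt0.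
set c := (r - 1) ^+ 2; have c0 : 0 < c by rewrite exprn_gt0.
(* Once [n - 1 >= 2 |B| / c], the quadratic term [n (n - 1) / 2 * c] alone is at least [|B| n]. *)
exists (Num.bound (2 * `|B| / c)).+1 => n Nn.
have := bernoulli2 n (ltW h0); rewrite [1 + (r - 1)]addrC subrK -/c => H.
apply: le_trans H; have n0 : 0 <= n%:R * (r - 1) by rewrite mulr_ge0 // ltW.
have : 2 * `|B| / c <= n.-1%:R.
  apply: le_trans (_ : (Num.bound (2 * `|B| / c))%:R <= _); last by rewrite ler_nat; lia.
  by apply/ltW/archi_boundP; rewrite divr_ge0 ?mulr_ge0 // ltW.
rewrite ler_pdivrMr // => Bn.
have E : 'C(n, 2)%:R * 2 = n%:R * n.-1%:R :> R.
  by rewrite -!natrM mulnC -mul_bin_diag bin1.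
have nn : 0 <= n%:R :> R by [].
have := ler_wpM2l nn Bn; have := ler_wpM2r nn (ler_norm B).
rewrite [n%:R * (n.-1%:R * c)]mulrA -E; lra.
Qed.

Lemma sum_geometric (a : R) m : a != 0 ->
  (a^-1 - 1) * \sum_(j < m) a ^+ j.+1 = 1 - a ^+ m.
Proof.
move=> a0; elim: m => [|m IH]; first by rewrite big_ord0 mulr0 expr0 subrr.
rewrite big_ord_recr /= mulrDr IH mulrBl exprS mulKf // mul1r; ring.
Qed.

Section Kraft.
Variables (I : finType) (wt : I -> nat) (lam : R).
Hypothesis lam1 : 1 <= lam.
Hypothesis kraft : \sum_i lam^-1 ^+ wt i <= 1.

Lemma sum_words k : \sum_(u <- words I k) lam^-1 ^+ word_weight wt u =
  (\sum_i lam^-1 ^+ wt i) ^+ k.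
Proof.
elim: k => [|k IH] /=; first by rewrite big_seq1 expr0.
rewrite big_allpairs_dep exprS -IH mulr_suml big_enum /=; apply: eq_bigr => i _.
by rewrite mulr_sumr; apply: eq_bigr => u _; rewrite /word_weight /= exprD.
Qed.

(** Every light word contributes at least [lam^-1 ^+ n] to the sum over words of [lam^-1] to the
    weight. By [kraft] the words of one length contribute at most 1, and only [n] lengths occur. *)
Lemma size_light_words n : (size (light_words wt n))%:R <= n%:R * lam ^+ n.
Proof.
have lam0 : 0 < lam by apply: lt_le_trans lam1.
have a0 : 0 <= lam^-1 by rewrite invr_ge0 ltW.
have a1 : lam^-1 <= 1 by rewrite invf_le1.
rewrite -ler_pdivrMr ?exprn_gt0 // -exprVn.
have le1 : (size (light_words wt n))%:R * lam^-1 ^+ n <=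
    \sum_(u <- light_words wt n) lam^-1 ^+ word_weight wt u.
  rewrite mulr_natl -count_predT -iter_addr_0 -big_const_seq big_seq [leRHS]big_seq.
  apply: ler_sum => u; rewrite mem_filter => /andP[un _].
  by apply: ler_wiXn2l => //; apply: ltnW.
apply: le_trans le1 _; rewrite /light_words big_filter.
apply: le_trans (_ : \sum_(u <- flatten [seq words I k | k <- iota 0 n]) lam^-1 ^+ word_weight wt u <= _).
  rewrite [leRHS](bigID (fun u => word_weight wt u < n)%N) /= lerDl.
  by apply: sumr_ge0 => u _; apply: exprn_ge0.
rewrite big_flatten big_map -[n%:R]/(n%:R) -[X in _ <= X%:R](size_iota 0 n).
elim: (iota 0 n) => [|k s IH]; first by rewrite big_nil.
rewrite big_cons /= -natr1 addrC lerD // sum_words.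
by apply: exprn_ile1 => //; apply: sumr_ge0 => i _; apply: exprn_ge0.
Qed.
End Kraft.

Section RunFree.
Variables (A : finType) (x : A) (Q : nat) (rho : R).
Hypothesis rho1 : 1 < rho.
Hypothesis branching : rho - 1 <= #|A|.-1%:R * (1 - rho^-1 ^+ Q.+1).

(** Recursion on the first letter: the [#|A|.-1] letters other than [x] restore the allowance [Q],
    while [x] uses up one unit of [k]. By [branching], the left side grows no faster than this
    recursion; for [k = 0] the missing contribution of [x] matches [1 - rho^-1 ^+ 0 = 0]. *)
Lemma count_run_free_lb l k : (k <= Q)%N ->
  rho ^+ l * (1 - rho^-1 ^+ k.+1) <= (count (run_free x Q k) (words A l))%:R.
Proof.
have rho0 : 0 < rho by apply: lt_trans rho1.
have a0 : 0 < rho^-1 by rewrite invr_gt0.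
elim: l k => [|l IH] k kQ.
  by rewrite expr0 mul1r /= lerBlDr lerDl ltW // exprn_gt0.
have countE : count (run_free x Q k) (words A l.+1) =
    (#|A|.-1 * count (run_free x Q Q) (words A l) +
     (if k is k'.+1 then count (run_free x Q k') (words A l) else 0))%N.
  rewrite /= count_flatten -map_comp sumnE big_map big_enum /= (bigD1 x) //= addnC.
  rewrite count_map (eq_count (a2 := fun w => if k is k'.+1 then run_free x Q k' w else false)); last first.
    by move=> w /=; rewrite eqxx.
  congr (_ + _)%N; last by case: (k) => [|k'] //; rewrite count_pred0.
  rewrite (eq_bigr (fun=> count (run_free x Q Q) (words A l))) => [|c cx].
    by rewrite sum_nat_const (cardC1 x).
  by rewrite count_map; apply: eq_count => w /=; rewrite (negbTE cx).
have rl0 : 0 <= rho ^+ l by rewrite exprn_ge0 // ltW.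
have key : rho ^+ l.+1 * (1 - rho^-1 ^+ k.+1) =
    rho ^+ l * (rho - 1) + rho ^+ l * (1 - rho^-1 ^+ k).
  by rewrite exprSr [rho^-1 ^+ k.+1]exprS; field; rewrite gt_eqF.
rewrite countE key natrD natrM lerD //.
  apply: le_trans (ler_wpM2l rl0 branching) _.
  by rewrite mulrCA ler_wpM2l // IH.
case: k kQ {countE key} => [|k] kQ; first by rewrite expr0 subrr mulr0.
by apply: IH; apply: ltnW.
Qed.
End RunFree.

(** [J] stands for the basis without [x], and ['I_m.+1 * J] for the Engel commutators with their
    weights. Light words grow at a rate at most [lam] and run-free words at least like [rho ^ n],
    with [lam < rho < #|A|]. The summand [n] covers the powers of [x] missing from the Engel
    union. *)
Lemma light_words_negligible (A J : finType) (x : A) (m p : nat) :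
  prime p -> (0 < #|J|)%N -> #|A|.-1 = #|J| ->
  exists Q e, Q.+1 = (p ^ e)%N /\ forall B : R, exists N, forall n, (N <= n)%N ->
    (Q.+3 <= n)%N /\
    B * (size (light_words (fun ij : 'I_m.+1 * J => (ij.1 : nat).+1) n) + n)%:R <=
      (count (run_free x Q Q) (words A (n - Q.+3)))%:R.
Proof.
move=> p_pr J0 AJ; have [d dE] : exists d : R, d = #|J|%:R + 1 by eexists.
(* Without the bound on the weights the growth rate would be [d], since the series
   [#|J| * d ^ (- j)] over [j >= 1] sums to 1; [del] bounds from below the loss caused by stopping
   at weight [m + 1]. *)
have [del delE] : exists del : R, del = d^-1 ^+ m.+1 by eexists.
have j1 : 1 <= #|J|%:R :> R by rewrite ler1n.
have d2 : 2 <= d by lra.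
have d0 : 0 < d by lra.
have dV0 : 0 <= d^-1 by rewrite invr_ge0 ltW.
have dV : d^-1 <= 2^-1 by rewrite lef_pV2 // posrE; lra.
have del0 : 0 < del by rewrite delE exprn_gt0 // invr_gt0.
have del2 : del <= 2^-1.
  rewrite delE exprS; apply: le_trans dV; rewrite ler_piMr //.
  by apply: exprn_ile1 => //; rewrite invf_le1 //; lra.
have [lam lamE] : exists l, l = d - del by eexists.
have [rho rhoE] : exists r, r = d - del / 2 by eexists.
have lam1 : 1 < lam by lra.
have lam0 : 0 < lam by lra.
have lr : lam < rho by lra.
have rho0 : 0 < rho by lra.
have rho1 : 1 < rho by lra.
have kraft : \sum_(ij : 'I_m.+1 * J) lam^-1 ^+ (ij.1 : nat).+1 <= 1.
  rewrite -(pair_bigA _ (fun (i : 'I_m.+1) (_ : J) => lam^-1 ^+ i.+1)) /=.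
  rewrite (eq_bigr (fun i : 'I_m.+1 => #|J|%:R * lam^-1 ^+ i.+1)); last first.
    by move=> i _; rewrite sumr_const mulr_natl.
  rewrite -mulr_sumr; have := @sum_geometric lam^-1 m.+1.
  rewrite invr_eq0 gt_eqF // invrK => /(_ isT) E.
  have l1 : 0 < lam - 1 by lra.
  rewrite -(ler_pM2l l1) mulrCA E mulr1.
  (* What remains is [del <= #|J| * lam^-1 ^+ m.+1], which follows from [lam <= d]. *)
  have : d^-1 ^+ m.+1 <= lam^-1 ^+ m.+1.
    have lV : d^-1 <= lam^-1 by rewrite lef_pV2 ?posrE //; lra.
    by apply: lerXn2r => //; rewrite nnegrE // invr_ge0 ltW.
  rewrite -delE => dl; have lV0 : 0 <= lam^-1 ^+ m.+1 by rewrite exprn_ge0 // invr_ge0 ltW.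
  have := ler_wpM2r lV0 j1; lra.
(* A large exponent makes [#|J| * rho^-1 ^+ Q.+1] at most [del / 2], the slack in [branching]. *)
have [e0 he0] := expr_eventually_ge (2 * #|J|%:R / del) rho1.
have pe0 : (0 < p ^ e0)%N by rewrite expn_gt0 prime_gt0.
have [Q QE] : exists Q, Q.+1 = (p ^ e0)%N by exists (p ^ e0).-1; rewrite prednK.
have e0Q : (e0 <= Q.+1)%N by rewrite QE; apply/ltnW/ltn_expl/prime_gt1.
exists Q, e0; split=> // B.
have branching : rho - 1 <= #|A|.-1%:R * (1 - rho^-1 ^+ Q.+1).
  have := he0 _ e0Q; rewrite ler_pdivrMr // exprVn AJ => H.
  have rq0 : 0 < rho ^+ Q.+1 by rewrite exprn_gt0.
  have : #|J|%:R / rho ^+ Q.+1 <= del / 2 by rewrite ler_pdivrMr //; lra.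
  lra.
(* [rho ^+ n / C] is the lower bound for the number of run-free words of length [n - Q.+3]. *)
pose C := rho ^+ Q.+3 / (1 - rho^-1 ^+ Q.+1).
have c0 : 0 < 1 - rho^-1 ^+ Q.+1.
  by rewrite subr_gt0 exprn_ilt1 ?invr_ge0 ?invf_lt1 // ltW.
have rl1 : 1 < rho / lam by rewrite ltr_pdivlMr // mul1r.
have [N hN] := natr_expr_eventually (`|B| * 2 * C) rl1.
exists (maxn N Q.+3) => n; rewrite geq_max => /andP[Nn Qn]; split=> //.
apply: le_trans (count_run_free_lb x rho1 branching (n - Q.+3) (leqnn Q)).
have := hN n Nn; rewrite expr_div_n ler_pdivlMr ?exprn_gt0 // => H.
have E : rho ^+ (n - Q.+3) * (1 - rho^-1 ^+ Q.+1) = rho ^+ n / C.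
  rewrite -[n in RHS](subnK Qn) exprD /C; field.
  by rewrite !gt_eqF // ?exprn_gt0.
have C0 : 0 < C by rewrite divr_gt0 // exprn_gt0.
rewrite E ler_pdivlMr //; apply: le_trans H.
have ub := size_light_words (ltW lam1) kraft n.
have n0 : 0 <= n%:R :> R by [].
have ln1 : 1 <= lam ^+ n by rewrite exprn_ege1 // ltW.
have sz : (size (light_words (fun ij : 'I_m.+1 * J => (ij.1 : nat).+1) n) + n)%:R <= 2 * (n%:R * lam ^+ n) :> R.
  by rewrite natrD; have := ler_wpM2l n0 ln1; lra.
rewrite (_ : `|B| * 2 * C * n%:R * lam ^+ n = `|B| * (2 * (n%:R * lam ^+ n)) * C); last by ring.
apply: ler_wpM2r; first exact: ltW.
by apply: le_trans (ler_wpM2r _ (ler_norm B)) _ => //; apply: ler_wpM2l.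
Qed.
End WordCounts.

End FiniteGroupsAndCounting.

From mathcomp Require Import finmap.
From mathcomp Require Import all_classical all_reals all_analysis.

(** * The Zassenhaus series of a finitely generated pro-p group *)

Local Open Scope classical_set_scope.
Local Open Scope group_scope.

(* Pointed by the neutral element, as the open cover lemma requires. *)
Definition pointed_group (G : topGroupType) : Type := G.
HB.instance Definition _ (G : topGroupType) := Topological.on (pointed_group G).
HB.instance Definition _ (G : topGroupType) :=
  isPointed.Build (pointed_group G) (1 : G).

(** * Closed and open subgroups *)

Section TopologicalGroups.
Variable G : topGroupType.
Implicit Types (A B H N : set G) (T : topologicalType).

Definition conj_stable A := forall x y, A x -> A (x ^ y).

Lemma continuousM T (f g : T -> G) : continuous f -> continuous g ->
  continuous (fun t => f t * g t).
Proof.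
move=> cf cg t; have Fm := mulg_continuous (f t, g t).
apply: (cvg_trans _ Fm); apply: (cvg_comp _ (fun z : G * G => z.1 * z.2) (cvg_pair (cf t) (cg t))).
exact: cvg_id.
Qed.

Lemma continuousV T (f : T -> G) : continuous f -> continuous (fun t => (f t)^-1).
Proof. by move=> cf t; apply: continuous_comp (cf t) (invg_continuous (f t)). Qed.

Lemma continuous_mull (c : G) : continuous (fun x => c * x).
Proof.
apply: (@continuousM G (fun=> c) (fun x => x)); first exact: cst_continuous.
by move=> ?; apply: cvg_id.
Qed.

Lemma continuous_mulr (c : G) : continuous (fun x => x * c).
Proof.
apply: (@continuousM G (fun x => x) (fun=> c)); last exact: cst_continuous.
by move=> ?; apply: cvg_id.
Qed.

Lemma continuous_conjg T (f g : T -> G) : continuous f -> continuous g ->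
  continuous (fun t => f t ^ g t).
Proof. by move=> cf cg; apply: continuousM (continuousV cg) (continuousM cf cg). Qed.

Lemma closed_preimage T T' (f : T -> T') (C : set T') :
  continuous f -> closed C -> closed [set t | C (f t)].
Proof. by move=> /continuous_closedP cf cC; apply: cf. Qed.

Lemma open_preimage T T' (f : T -> T') (C : set T') :
  continuous f -> open C -> open [set t | C (f t)].
Proof. by move=> /continuousP cf oC; apply: cf. Qed.

Lemma topgen_closed_subgroup A : closed_subgroup (topgen A).
Proof.
split; last by apply: closed_bigI => H [[]].
split=> [H [[[] //]]|x y Ax Ay H HA|x Ax H HA].
- by have [[[_ HM _] _] _] := HA; apply: HM; [apply: Ax|apply: Ay].
- by have [[[_ _ HV] _] _] := HA; apply: HV; apply: Ax.
Qed.

Lemma topgen_sub A H : closed_subgroup H -> A `<=` H -> topgen A `<=` H.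
Proof. exact: smallest_sub. Qed.

Lemma mem_topgen A x : A x -> topgen A x.
Proof. exact: sub_gen_smallest. Qed.

Lemma closed_subgroup_conj H y : closed_subgroup H -> closed_subgroup [set x | H (x ^ y)].
Proof.
move=> [[H1 HM HV] Hc]; split; last first.
  by apply: closed_preimage Hc; apply: continuous_conjg; [by move=> ?; apply: cvg_id | exact: cst_continuous].
split=> [|a b|a] /=; first by rewrite conj1g.
- by rewrite conjMg; apply: HM.
- by rewrite conjVg; apply: HV.
Qed.

Lemma topgen_conj_stable A : conj_stable A -> conj_stable (topgen A).
Proof.
move=> An x y Ax; suff : topgen A `<=` [set x | topgen A (x ^ y)] by apply.
apply: topgen_sub; first exact: closed_subgroup_conj (topgen_closed_subgroup A).
by move=> a Aa /=; apply: mem_topgen; apply: An.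
Qed.

Lemma mulset_conj_stable A B : conj_stable A -> conj_stable B -> conj_stable (mulset A B).
Proof.
move=> An Bn _ y [a Aa [b Bb <-]]; rewrite conjMg.
by exists (a ^ y); [exact: An|exists (b ^ y); [exact: Bn|]].
Qed.

Lemma mulset_subgroup A B : subgroup A -> subgroup B -> conj_stable B ->
  subgroup (mulset A B).
Proof.
move=> [A1 AM AV] [B1 BM BV] Bn; split.
- by exists 1 => //; exists 1 => //; rewrite mulg1.
- move=> _ _ [a Aa [b Bb <-]] [a' Aa' [b' Bb' <-]].
  exists (a * a'); first exact: AM.
  exists (b ^ a' * b'); first by apply: BM => //; apply: Bn.
  by rewrite /conjg !mulgA mulgK.
- move=> _ [a Aa [b Bb <-]]; exists a^-1; first exact: AV.
  exists (b^-1 ^ a^-1); first by apply/Bn/BV.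
  by rewrite /conjg invgK invMg !mulgA mulVg mul1g.
Qed.

Lemma mulset_closed A B : compact [set: G] -> hausdorff_space G ->
  closed A -> closed B -> closed (mulset A B).
Proof.
move=> cG hG cA cB; apply: compact_closed => //.
have -> : mulset A B = (fun z : G * G => z.1 * z.2) @` (A `*` B).
  apply/seteqP; split=> [_ [a Aa [b Bb <-]]|_ [[a b] [/= Aa Bb] <-]].
    by exists (a, b).
  by exists a => //; exists b.
apply: continuous_compact; first exact/continuous_subspaceT/mulg_continuous.
by apply: compact_setX; apply: subclosed_compact cG _.
Qed.

Lemma subset_mulsetl A B : B 1 -> A `<=` mulset A B.
Proof. by move=> B1 a Aa; exists a => //; exists 1 => //; rewrite mulg1. Qed.

Lemma subset_mulsetr A B : A 1 -> B `<=` mulset A B.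
Proof. by move=> A1 b Bb; exists 1 => //; exists b => //; rewrite mul1g. Qed.

Lemma mulset_sub A B H : subgroup H -> A `<=` H -> B `<=` H -> mulset A B `<=` H.
Proof. by move=> [_ HM _] AH BH _ [a /AH Ha [b /BH Hb <-]]; apply: HM. Qed.

Lemma open_left_coset N x : open N -> open [set x * y | y in N].
Proof.
move=> oN; rewrite (_ : [set _ | _ in _] = [set z | N (x^-1 * z)]).
  by by apply: open_preimage oN; apply: continuous_mull.
apply/seteqP; split=> [_ [y Ny <-]|z Nz] /=; first by rewrite mulKg.
by exists (x^-1 * z) => //; rewrite mulKVg.
Qed.

Lemma closed_left_coset N x : closed N -> closed [set x * y | y in N].
Proof.
move=> cN; rewrite (_ : [set _ | _ in _] = [set z | N (x^-1 * z)]).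
  by by apply: closed_preimage cN; apply: continuous_mull.
apply/seteqP; split=> [_ [y Ny <-]|z Nz] /=; first by rewrite mulKg.
by exists (x^-1 * z) => //; rewrite mulKVg.
Qed.

Lemma left_coset_eq H x y : subgroup H -> H (x^-1 * y) ->
  [set x * z | z in H] = [set y * z | z in H].
Proof.
move=> [H1 HM HV] Hxy; apply/seteqP; split=> _ [z Hz <-].
  exists ((x^-1 * y)^-1 * z); first by apply: HM => //; apply: HV.
  by rewrite invMg invgK !mulgA mulgV mul1g.
by exists (x^-1 * y * z); [exact: HM|rewrite !mulgA mulgV mul1g].
Qed.

Lemma left_coset_eqP H x y : subgroup H ->
  ([set x * z | z in H] = [set y * z | z in H]) <-> H (x^-1 * y).
Proof.
move=> sH; split; last exact: left_coset_eq.
move=> E; have [H1 _ _] := sH.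
have : [set y * z | z in H] y by exists 1 => //; rewrite mulg1.
by rewrite -E => -[z Hz <-]; rewrite mulKg.
Qed.

Lemma open_subgroup_closed H : subgroup H -> open H -> closed H.
Proof.
move=> sH oH; have [H1 HM HV] := sH; rewrite -openC.
rewrite (_ : ~` H = \bigcup_(x in ~` H) [set x * z | z in H]).
  by apply: bigcup_open => x _; apply: open_left_coset.
apply/seteqP; split=> [x nHx|_ [x nHx [z Hz <-]] Hxz].
  by exists x => //; exists 1 => //; rewrite mulg1.
by apply: nHx; rewrite -(mulgK z x); apply: HM => //; apply: HV.
Qed.

Lemma open_cosets_finite N : compact [set: G] -> open N -> subgroup N ->
  finite_set (left_cosets [set: G] N).
Proof.
move=> cG oN sN; have [N1 _ _] := sN.
have := cG : compact [set: pointed_group G].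
rewrite compact_cover => /(_ (pointed_group G) [set: G] (fun x => [set x * y | y in N])).
case=> [x _|x _|D _ GD]; first exact: open_left_coset.
  by exists x => //; exists 1 => //; rewrite mulg1.
apply: (@sub_finite_set _ _ [set [set x * y | y in N] | x in [set` D]]).
  move=> _ [x _ <-]; have [d Dd [y Ny dy]] := GD x I.
  by exists d => //; apply: left_coset_eq => //; rewrite -dy mulKg.
exact/finite_image/finite_fset.
Qed.

Lemma finite_cosets_open N : closed N -> subgroup N ->
  finite_set (left_cosets [set: G] N) -> open N.
Proof.
move=> cN sN fN; have [N1 _ _] := sN; rewrite -closedC.
rewrite (_ : ~` N = \bigcup_(C in left_cosets setT N `&` [set C | C <> N]) C).
  apply: closed_bigcup; first exact: finite_setIl.
  by move=> _ [[x _ <-] _]; apply: closed_left_coset.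
have NE : N = [set 1 * z | z in N].
  by apply/seteqP; split=> [z Nz|_ [z Nz <-]]; [exists z|]; rewrite ?mul1g.
apply/seteqP; split=> [x nNx|x [C [[y _ <-] yN] Cx] Nx].
  exists [set x * z | z in N]; last by exists 1 => //; rewrite mulg1.
  split; first by exists x.
  by move=> /= E; apply: nNx; rewrite -E; exists 1 => //; rewrite mulg1.
apply: yN => /=; rewrite [RHS]NE; apply/left_coset_eqP => //.
have [_ NM NV] := sN; case: Cx => z Nz zx.
by rewrite mulg1; apply: (NV); rewrite -(mulgK z y) zx; apply: NM => //; apply: NV.
Qed.

End TopologicalGroups.

(** * Closure properties and minimality of the Zassenhaus series *)

Section ZassenhausSeries.
Variables (p : nat) (G : topGroupType).
Hypothesis p_pr : prime p.
Hypothesis cG : compact [set: G].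
Hypothesis hG : hausdorff_space G.
Implicit Types (A B H N : set G).

Let p_gt1 : (1 < p)%N := prime_gt1 p_pr.
Notation Z := (zassenhaus p G).

Definition closed_normal H := closed_subgroup H /\ conj_stable H.

Lemma closed_normal_mulset A B : closed_normal A -> closed_normal B ->
  closed_normal (mulset A B).
Proof.
move=> [[sA cA] nA] [[sB cB] nB]; split; last exact: mulset_conj_stable.
by split; [apply: mulset_subgroup|apply: mulset_closed].
Qed.

Lemma closed_normal1 : closed_normal [set 1].
Proof.
split; last by move=> x y ->; apply: conj1g.
split; last exact/accessible_closed_set1/hausdorff_accessible.
by split=> // [x y -> ->|x ->]; rewrite ?mulg1 ?invg1.
Qed.

Lemma closed_normal_big (s : seq nat) (F : nat -> set G) :
  (forall j, j \in s -> closed_normal (F j)) ->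
  closed_normal (\big[@mulset G/[set 1]]_(j <- s) F j) /\
  forall j, j \in s -> F j `<=` \big[@mulset G/[set 1]]_(j <- s) F j.
Proof.
elim: s => [|j s IH] nF; first by rewrite big_nil; split=> //; apply: closed_normal1.
have nj : closed_normal (F j) by apply: nF; rewrite mem_head.
have [ns sub] : closed_normal (\big[@mulset G/[set 1]]_(j <- s) F j) /\
    forall j, j \in s -> F j `<=` \big[@mulset G/[set 1]]_(j <- s) F j.
  by apply: IH => k ks; apply: nF; rewrite inE ks orbT.
rewrite big_cons; split; first exact: closed_normal_mulset.
have [[[B1 _ _] _] _] := ns; have [[[A1 _ _] _] _] := nj.
move=> k; rewrite inE => /predU1P[->|/sub ks]; first exact: subset_mulsetl.
by apply: subset_trans ks _; apply: subset_mulsetr.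
Qed.

Lemma closed_normal_powers A n : conj_stable A -> closed_normal (powers A n).
Proof.
move=> nA; split; first exact: topgen_closed_subgroup.
apply: topgen_conj_stable => _ y [x Ax <-].
by exists (x ^ y); [apply: nA|rewrite conjXg].
Qed.

Lemma closed_normal_commutators A B : conj_stable A -> conj_stable B ->
  closed_normal (commutators A B).
Proof.
move=> nA nB; split; first exact: topgen_closed_subgroup.
apply: topgen_conj_stable => _ y [a Aa [b Bb <-]].
by exists (a ^ y); [apply: nA|exists (b ^ y); [apply: nB|rewrite conjRg]].
Qed.

Lemma closed_normalT : closed_normal [set: G].
Proof. by split=> //; split=> //; apply: closedT. Qed.

Let ceil i := ((i + p.-1) %/ p)%N.

(** All properties go through one strong induction: the products of sets in the definition are
    closed normal subgroups containing their factors because the earlier terms are conjugation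
    stable. *)
Lemma zassenhaus_spec i : closed_normal (Z i) /\
  ((2 <= i)%N -> (forall x, Z (ceil i) x -> Z i (x ^+ p)) /\
    (forall j x y, (0 < j < i)%N -> Z j x -> Z (i - j)%N y -> Z i [~ x, y])).
Proof.
have [n] := ubnP i; elim: n i => // n IH i; rewrite ltnS => i_n.
have [i2|i2] := ltnP 1 i; last first.
  have -> : Z i = [set: G] by case: i i2 {i_n} => [|[|]].
  by split=> //; apply: closed_normalT.
rewrite (zassenhausE G p_gt1 i2).
have nP : closed_normal (powers (Z (ceil i)) p).
  apply: closed_normal_powers; apply: (IH _ _).1.2.
  by apply: leq_trans i_n; apply: zassenhaus_ceil_lt.
pose F j := commutators (Z j) (Z (i - j)%N).
have nF j : j \in index_iota 1 i -> closed_normal (F j).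
  rewrite mem_index_iota => ji; apply: closed_normal_commutators; apply: (IH _ _).1.2; lia.
have [nC subC] := closed_normal_big nF.
rewrite /zassenhaus_step; split; first exact: closed_normal_mulset.
have [[[B1 _ _] _] _] := nC; have [[[A1 _ _] _] _] := nP.
move=> _; split=> [x Zx|j x y ji Zx Zy].
  by apply: subset_mulsetl => //; apply: mem_topgen; exists x.
apply: subset_mulsetr => //; apply: (subC j); first by rewrite mem_index_iota.
by apply: mem_topgen; exists x => //; exists y.
Qed.

Lemma zassenhaus_subgroup i : closed_subgroup (Z i).
Proof. exact: (zassenhaus_spec i).1.1. Qed.

Lemma zassenhaus_conj i : conj_stable (Z i).
Proof. exact: (zassenhaus_spec i).1.2. Qed.

Lemma zassenhaus_sub i H : (1 < i)%N -> closed_subgroup H ->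
  (forall x, Z (ceil i) x -> H (x ^+ p)) ->
  (forall j x y, (0 < j < i)%N -> Z j x -> Z (i - j)%N y -> H [~ x, y]) ->
  Z i `<=` H.
Proof.
move=> i1 sH HX HR; rewrite (zassenhausE G p_gt1 i1).
apply: mulset_sub; first exact: sH.1.
  by apply: topgen_sub => // _ [x Zx <-]; apply: HX.
rewrite big_seq; elim/big_ind: _ => [_ ->|A B AH BH|j].
- by case: sH => -[].
- by apply: mulset_sub => //; apply: sH.1.
rewrite mem_index_iota => ji; apply: topgen_sub => // _ [x Zx [y Zy <-]].
exact: (HR j).
Qed.

Lemma zassenhaus0 : Z 0 = [set: G]. Proof. by []. Qed.

Lemma zassenhaus_commg i j x y : Z i x -> Z j y -> Z (i + j)%N [~ x, y].
Proof.
move=> Zx Zy; case: (posnP i) => [->|i0].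
  have [[_ ZM ZV] _] := zassenhaus_subgroup j; rewrite add0n -invgR.
  rewrite commgEl invMg invgK.
  by apply: ZM => //; apply/ZV/zassenhaus_conj.
case: (posnP j) => [->|j0].
  have [[_ ZM ZV] _] := zassenhaus_subgroup i; rewrite addn0 commgEl.
  by apply: ZM; [exact: ZV|exact: zassenhaus_conj].
have [_ [|_ H]] := zassenhaus_spec (i + j)%N; first by lia.
by apply: (H i) => //; [lia|rewrite addKn].
Qed.

Lemma zassenhausX i x : Z i x -> Z (p * i)%N (x ^+ p).
Proof.
case: (posnP i) => [->|i0] Zx; first by rewrite muln0 zassenhaus0.
have [_ [|H _]] := zassenhaus_spec (p * i)%N; first by nia.
apply: H; rewrite /ceil mulnC divnMDl ?prime_gt0 // divn_small ?addn0 //.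
by rewrite prednK ?prime_gt0.
Qed.

(** Generators of consecutive terms are compared: the ceiling is monotone, and in a commutator the
    second index can be lowered by one. If that index is 1, normality of the term suffices
    instead. *)
Lemma zassenhausS i : Z i.+1 `<=` Z i.
Proof.
have [n] := ubnP i; elim: n i => // n IH i; rewrite ltnS => i_n.
case: i i_n => [//|[//|i]] i_n.
have anti a b : (a <= b <= i.+2)%N -> Z b `<=` Z a.
  move=> /andP[/subnK <-]; elim: (b - a)%N => [|k IHk] bk; first by rewrite add0n.
  apply: subset_trans _ (IHk _); last by lia.
  by rewrite addSn; apply: IH; lia.
apply: zassenhaus_sub => //; first exact: zassenhaus_subgroup.
  move=> x Zx; have [_ [//|H _]] := zassenhaus_spec i.+2; apply: H.
  apply: (anti _ _ _ _ Zx); apply/andP; split.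
    by apply: leq_div2r; rewrite leq_add2r.
  by rewrite -ltnS; apply: zassenhaus_ceil_lt.
move=> j x y ji Zx Zy; have [jlt|jge] := ltnP j i.+2.
  have [_ [//|_ H]] := zassenhaus_spec i.+2; apply: (H j) => //; first by lia.
  by apply: (anti _ _ _ _ Zy); lia.
have -> : i.+2 = (j + 0)%N by lia.
exact: zassenhaus_commg.
Qed.

Lemma zassenhaus_anti i j : (i <= j)%N -> Z j `<=` Z i.
Proof.
move=> /subnK <-; elim: (j - i)%N => // k IH.
exact: subset_trans (@zassenhausS _) IH.
Qed.

(** The preimages of the [P i] are closed subgroups that satisfy the power and commutator
    conditions, and the Zassenhaus series is the fastest descending series of this kind. *)
Lemma zassenhaus_np_series (gT : finGroupType) (P : nat -> {group gT}) (phi : G -> gT) :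
  np_series p P -> {morph phi : x y / x * y} ->
  (forall x, phi x \in P 1%N) -> (forall i, closed [set x | phi x \in P i]) ->
  forall i x, Z i x -> phi x \in P i.
Proof.
move=> [PS PR PX] phiM phi1 cP i.
have phi_1 : phi 1 = 1 by apply: (mulgI (phi 1)); rewrite -phiM !mulg1.
have phiV x : phi x^-1 = (phi x)^-1.
  by apply: (mulgI (phi x)); rewrite -phiM !mulgV phi_1.
have phiX x n : phi (x ^+ n) = phi x ^+ n.
  by elim: n => [|n IH]; rewrite ?phi_1 // !expgS phiM IH.
have sub k : closed_subgroup [set x | phi x \in P k].
  split; last exact: cP.
  split=> [|x y|x] /=; first by rewrite phi_1 group1.
  - by rewrite phiM; apply: groupM.
  - by rewrite phiV groupV.
have P_anti a b : (a <= b)%N -> P b \subset P a.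
  by move=> /subnK <-; elim: (b - a)%N => // k IH; apply: fintype.subset_trans (PS _) IH.
have [n] := ubnP i; elim: n i => // n IH i; rewrite ltnS => i_n.
case: (ltnP 1 i) => [i1|i1]; last first.
  by move=> x _; case: i i1 {i_n} => [|[|]] // _; exact: (fintype.subsetP (PS 0%N) _ (phi1 x)).
move=> x; suff : Z i `<=` [set x | phi x \in P i] by apply.
apply: zassenhaus_sub => // [y Zy|j y z ji Zy Zz] /=.
  have cn : (ceil i < n)%N by apply: leq_trans i_n; apply: zassenhaus_ceil_lt.
  have ic : (i <= p * ceil i)%N.
    have := divn_eq (i + p.-1) p; have := ltn_pmod (i + p.-1) (prime_gt0 p_pr).
    by rewrite /ceil mulnC; lia.
  by rewrite phiX; apply: (fintype.subsetP (P_anti _ _ ic)); apply/PX/IH.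
have -> : phi [~ y, z] = [~ phi y, phi z] by rewrite /commg /conjg !phiM !phiV.
have -> : i = (j + (i - j))%N by lia.
by apply: PR; apply: IH => //; lia.
Qed.

End ZassenhausSeries.

(** * Quotients by open normal subgroups as finite groups *)

Section FiniteQuotient.
Variables (G : topGroupType) (N : set G).

(** The quotient is realized by permutations of the cosets. Left multiplication by inverses matches
    the order in which permutations are composed, and normality makes [N] act trivially. *)
Lemma finite_quotient : compact [set: G] -> open_normal_subgroup N ->
  exists (gT : finGroupType) (pi : G -> gT),
    {morph pi : x y / x * y} /\ (forall x, pi x = 1 <-> N x).
Proof.
move=> cG [sN oN nN]; have [N1 NM NV] := sN.
have fin := open_cosets_finite cG oN sN.
pose cs : {fset set G} := fset_set (left_cosets [set: G] N).
pose coset (x : G) : set G := [set x * z | z in N].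
have cs_coset x : coset x \in cs by rewrite in_fset_set // inE; exists x.
pose c (x : G) : cs := [` cs_coset x]%fset.
have repP (t : cs) : exists x, c x = t.
  have : fsval t \in cs by exact: fsvalP.
  rewrite in_fset_set // inE => -[x _ E]; exists x.
  exact: val_inj.
pose rep t := sval (cid (repP t)).
have repK t : c (rep t) = t by rewrite /rep; case: cid.
have cE x y : c x = c y <-> N (x^-1 * y).
  split=> [/(congr1 val)/= /left_coset_eqP H|H]; first exact: H.
  by apply: val_inj; apply: left_coset_eq.
pose act g t := c (g^-1 * rep t).
have actE g x : act g (c x) = c (g^-1 * x).
  apply/cE; rewrite invMg invgK -mulgA mulKVg.
  by apply/cE; rewrite repK.
have actM g h t : act (g * h) t = act h (act g t).
  by rewrite -(repK t) !actE invMg mulgA.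
have act1 t : act 1 t = t by rewrite -(repK t) actE invg1 mul1g.
have act_inj g : injective (act g).
  by apply: (can_inj (g := act g^-1)) => t; rewrite -actM mulgV act1.
exists {perm cs}, (fun g => perm (act_inj g)); split=> [g h|g].
  by apply/permP => t; rewrite permM !permE actM.
split=> [/permP/(_ (c 1))|Ng].
  by rewrite perm1 permE actE mulg1 => /cE; rewrite invgK mulg1.
apply/permP => t; rewrite perm1 permE -(repK t) actE; apply/cE.
rewrite invMg invgK -mulgA; have := nN _ (rep t) Ng.
by rewrite /conjg.
Qed.

Variables (gT : finGroupType) (pi : G -> gT).
Hypothesis piM : {morph pi : x y / x * y}.
Hypothesis kerpi : forall x, pi x = 1 <-> N x.

Lemma quot1 : pi 1 = 1. Proof. by apply: (mulgI (pi 1)); rewrite -piM !mulg1. Qed.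

Lemma quotV x : pi x^-1 = (pi x)^-1.
Proof. by apply: (mulgI (pi x)); rewrite -piM !mulgV quot1. Qed.

Lemma quotX x n : pi (x ^+ n) = pi x ^+ n.
Proof. by elim: n => [|n IH]; rewrite ?quot1 // !expgS piM IH. Qed.

Lemma quotR x y : pi [~ x, y] = [~ pi x, pi y].
Proof. by rewrite /commg /conjg !piM !quotV. Qed.

Lemma quot_eqP x y : pi x = pi y <-> N (x^-1 * y).
Proof.
rewrite -kerpi piM quotV; split=> [->|]; first by rewrite mulVg.
by move=> E; apply: (mulgI (pi x)^-1); rewrite E mulVg.
Qed.

Definition quot_image (H : set G) : {set gT} :=
  finset (fun s => `[< exists2 h, H h & pi h = s >]).

Lemma mem_quot_image (H : set G) s :
  (s \in quot_image H) <-> exists2 h, H h & pi h = s.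
Proof. by rewrite inE; split=> [/asboolP|/asboolP]. Qed.

Lemma quot_image_in (H : set G) h : H h -> pi h \in quot_image H.
Proof. by move=> Hh; apply/mem_quot_image; exists h. Qed.

Lemma quot_image_group_set (H : set G) : subgroup H -> group_set (quot_image H).
Proof.
move=> [H1 HM _]; apply/group_setP; split; first by rewrite -quot1 quot_image_in.
move=> _ _ /mem_quot_image[x Hx <-] /mem_quot_image[y Hy <-].
by rewrite -piM; apply/quot_image_in/HM.
Qed.

Lemma quot_image_mulset (H : set G) : quot_image (mulset H N) = quot_image H.
Proof.
have N1 : N 1 by apply/kerpi/quot1.
apply/setP => s; apply/idP/idP => /mem_quot_image[h].
  move=> [x Hx [y /kerpi Ny <-]] <-.
  by rewrite piM Ny mulg1 quot_image_in.
by move=> Hh <-; apply/quot_image_in/subset_mulsetl.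
Qed.

Lemma group_index_quot (H : set G) : subgroup N ->
  group_index (mulset H N) N = #|quot_image H|.
Proof.
move=> sN; rewrite -quot_image_mulset; move: (mulset H N) => A.
rewrite /group_index.
have -> : left_cosets A N = (fun s => [set x | pi x = s]) @` [set s | s \in quot_image A].
  apply/seteqP; split=> [_ [x Ax <-]|_ [s /mem_quot_image[x Ax <-] <-]].
    exists (pi x); first exact: quot_image_in.
    apply/seteqP; split=> [y /esym/quot_eqP Nxy|_ [z /kerpi Nz <-]] /=.
      by exists (x^-1 * y) => //; rewrite mulKVg.
    by rewrite piM Nz mulg1.
  exists x => //; apply/seteqP; split=> [_ [z /kerpi Nz <-]|y /esym/quot_eqP Nxy] /=.
    by rewrite piM Nz mulg1.
  by exists (x^-1 * y) => //; rewrite mulKVg.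
have fin : finite_set [set s | s \in quot_image A].
  by apply: sub_finite_set (@finite_finset gT setT).
rewrite fset_set_image // card_in_imfset /=.
  have -> : fset_set [set s | s \in quot_image A] = [fset s in enum (quot_image A)]%fset.
    by apply/fsetP => s; rewrite in_fset_set // !inE mem_enum; apply/asboolP/idP.
  by rewrite card_fseq undup_id ?enum_uniq // -cardE.
move=> s t; rewrite !in_fset_set // !inE => /mem_quot_image[x _ <-] _ E.
by have : [set z | pi z = t] x by rewrite -E.
Qed.
End FiniteQuotient.

(** * Openness of the Zassenhaus series *)

Section Openness.
Variable G : topGroupType.
Hypothesis cG : compact [set: G].
Implicit Types (A B H K N : set G).

(** Schreier's lemma for topological generation: if [r] chooses representatives of the right cosets
    and [Y] is generated by the Schreier elements, the closed set [YT] is stable under the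
    generators and their inverses, hence is the whole group; its part in [U] is [Y]. *)
Lemma open_subgroup_fg (U : set G) : subgroup U -> open U ->
  finitely_generated G -> exists2 B, finite_set B & topgen B = U.
Proof.
move=> sO oO [A [finA genA]]; have [U1 UM UV] := sO.
have cO := open_subgroup_closed sO oO.
pose rc g : set G := [set x | U (x * g^-1)].
have rcE g h : U (g * h^-1) -> rc g = rc h.
  move=> Ugh; rewrite /rc; apply/seteqP; split=> x /= Ux.
    by rewrite -(mulgKV g x) -mulgA; apply: (UM).
  rewrite -(mulgKV h x) -mulgA; apply: (UM) => //.
  by rewrite -(invgK h) -invMg; apply: (UV).
(* The coset [U] is represented by 1, so that [y * t] can lie in [U] only for [t = 1]. *)
pose r g := if `[< U g >] then 1 else xget 1 (rc g).
have r_in g : U (r g * g^-1).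
  rewrite /r; case: asboolP => [Ug|_]; first by rewrite mul1g; apply: (UV).
  suff : rc g (xget 1 (rc g)) by [].
  by apply: xgetPex; exists g; rewrite /rc /= mulgV.
have r_O g : U (r g) -> r g = 1.
  move=> Org; rewrite /r; case: asboolP => // nUg; case: nUg.
  rewrite -(invgK g); apply: (UV); rewrite -(mulKg (r g) g^-1).
  by apply: (UM); [apply: (UV)|].
have r1 : r 1 = 1 by rewrite /r; case: asboolP.
have finT : finite_set (range r).
  have finC : finite_set (range rc).
    apply: (@sub_finite_set _ _ ((fun C : set G => [set x | C x^-1]) @` left_cosets setT U)).
      move=> _ [g _ <-]; exists [set g^-1 * y | y in U]; first by exists g^-1.
      apply/seteqP; split=> x /=.
        by move=> [y Oy E]; rewrite /rc /= -(invgK x) -E invMg invgK mulgK; apply: (UV).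
      by move=> Ox; exists (x * g^-1)^-1; [apply: (UV)|rewrite invMg invgK mulKg].
    exact/finite_image/open_cosets_finite.
  apply: (@sub_finite_set _ _ ([set 1] `|` xget 1 @` range rc)).
    move=> _ [g _ <-]; rewrite /r; case: asboolP => _; [by left|right].
    by exists (rc g) => //; exists g.
  by rewrite finite_setU; split; [exact: finite_set1|exact: finite_image].
pose As := A `|` [set a^-1 | a in A].
pose B := [set z.1 * z.2 * (r (z.1 * z.2))^-1 | z in range r `*` As].
have finB : finite_set B.
  apply: finite_image; apply: finite_setX => //.
  by rewrite finite_setU; split=> //; apply: finite_image.
have BO : B `<=` U.
  by move=> _ [z _ <-]; rewrite -(invgK (z.1 * z.2)) -invMg invgK; apply/UV/r_in.
exists B => //; apply/seteqP; split; first by apply: topgen_sub.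
set Y := topgen B; have [[Y1 YM YV] cY] := topgen_closed_subgroup B.
pose YT := \bigcup_(t in range r) [set y * t | y in Y].
have cYT : closed YT.
  apply: closed_bigcup => // t _.
  rewrite (_ : [set _ | _ in _] = [set z | Y (z * t^-1)]).
    by apply: closed_preimage cY; apply: continuous_mulr.
  apply/seteqP; split=> [_ [y Yy <-]|z Yz] /=; first by rewrite mulgK.
  by exists (z * t^-1) => //; rewrite mulgKV.
(* The stabilizer of [YT] under right translation; it is a closed subgroup containing [A], hence
   everything. *)
pose S := [set g | forall u, YT u -> YT (u * g) /\ YT (u * g^-1)].
have sS : closed_subgroup S.
  split.
    split=> [u Yu|g h Sg Sh u Yu|g Sg u Yu]; first by rewrite invg1 mulg1.
      rewrite invMg !mulgA; split; first by apply: (Sh _ (Sg _ Yu).1).1.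
      by apply: (Sg _ (Sh _ Yu).2).2.
    by rewrite invgK; have [? ?] := Sg _ Yu.
  rewrite (_ : S = \bigcap_(u in YT) ([set g | YT (u * g)] `&` [set g | YT (u * g^-1)])).
    apply: closed_bigI => u _; apply: closedI; apply: closed_preimage cYT.
      exact: continuous_mull.
    by move=> g; apply: continuous_comp (@invg_continuous G g) (@continuous_mull G u _).
  by apply/seteqP; split=> g Sg u Yu; have := Sg u Yu.
have AS : A `<=` S.
  move=> a Aa u [t [g _ tg] [y Yy <-]]; have tT : range r t by exists g.
  have step b : As b -> YT (y * t * b).
    move=> Ab; exists (r (t * b)); first by exists (t * b).
    exists (y * (t * b * (r (t * b))^-1)); last by rewrite !mulgA mulgKV.
    by apply: (YM) => //; apply: mem_topgen; exists (t, b).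
  by split; apply: step; [left|right; exists a].
have ST g : S g by have := topgen_sub sS AS; rewrite genA; apply.
move=> g Og; have YT1 : YT 1 by exists 1; [exists 1|exists 1 => //; rewrite mulg1].
have [+ _] := ST g 1 YT1; rewrite mul1g => -[_ [h _ <-] [y Yy E]].
have Oy : U y by apply: (topgen_sub (conj sO cO) BO).
have : U (r h) by rewrite -(mulKg y (r h)) E; apply: (UM) => //; apply: (UV).
by move/r_O => E1; rewrite -E E1 mulg1.
Qed.

(** [H / K] is abelian of exponent dividing [p]. Generators are adjoined one at a time; each
    intermediate group is a finite union of cosets of the previous one and so remains closed. *)
Lemma finite_cover_quotient (p : nat) H K A : (0 < p)%N ->
  closed_subgroup H -> closed_subgroup K -> K `<=` H ->
  (forall x y, H x -> H y -> K [~ x, y]) -> (forall x, H x -> K (x ^+ p)) ->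
  finite_set A -> topgen A = H ->
  exists2 D, finite_set D & forall x, H x -> exists2 d, D d & K (d^-1 * x).
Proof.
move=> p0 [[H1 HM HV] cH] [[K1 KM KV] cK] KH HR HX finA genA.
have HXn x n : H x -> H (x ^+ n).
  by move=> Hx; elim: n => [|n IH] //; rewrite expgS; apply: (HM).
have /finite_seqP[s sE] := finA.
have sH x : x \in s -> H x.
  by move=> xs; rewrite -genA; apply: mem_topgen; rewrite sE.
suff [D [E [finD [sE' cE] [KE EH sub ED]]]] : exists D E, [/\ finite_set D,
    closed_subgroup E & [/\ K `<=` E, E `<=` H, {subset s <= E} &
      forall x, E x -> exists2 d, D d & K (d^-1 * x)]].
  exists D => // x; rewrite -genA => Hx; apply: ED; apply: topgen_sub Hx; first by split.
  by rewrite sE => y /= ys; apply/set_mem/sub.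
elim: s sH {sE} => [|a s IH] sH.
  exists [set 1], K; split; first exact: finite_set1.
    by split.
  split=> // x Kx; exists 1 => //.
  by rewrite invg1 mul1g.
have [|D [E [finD [[E1 EM EV] cE] [KE EH sub ED]]]] := IH.
  by move=> x xs; apply: sH; rewrite inE xs orbT.
have Ha : H a by apply: sH; rewrite mem_head.
have Econj x k : E x -> E (x ^ (a ^+ k)).
  move=> Ex; rewrite -(mulKVg x (x ^ _)) -commgEl.
  by apply: (EM) => //; apply: KE; apply: (HR); [exact: EH|exact: HXn].
pose E' := \bigcup_(k in `I_p) [set a ^+ k * z | z in E].
have E'X k z : E z -> E' (a ^+ k * z).
  move=> Ez; exists (k %% p)%N; first by rewrite /= ltn_mod.
  exists (a ^+ p ^+ (k %/ p) * z).
    apply: (EM) => //; apply: KE; elim: (k %/ p)%N => // n IHn.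
    by rewrite expgS; apply: (KM) => //; apply: (HX).
  by rewrite -expgM mulgA -expgD mulnC addnC -divn_eq.
have E'M x y : E' x -> E' y -> E' (x * y).
  move=> [k _ [z Ez <-]] [l _ [t Et <-]].
  rewrite (_ : _ * _ = a ^+ (k + l) * (z ^ (a ^+ l) * t)).
    by apply: E'X; apply: (EM) => //; apply: Econj.
  by rewrite expgD /conjg !mulgA mulgK.
have E'V x : E' x -> E' x^-1.
  move=> [k kp [z Ez <-]].
  rewrite (_ : _^-1 = a ^+ (k * p.-1) * (((a ^+ (k * p))^-1 * z^-1 ^ (a ^+ k)^-1))); last first.
    have kpE : (k * p = k + k * p.-1)%N by rewrite -mulnS prednK.
    by rewrite kpE expgD [(a ^+ k * a ^+ _)^-1]invMg /conjg invgK !mulgA mulgV mul1g mulVg mul1g invMg.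
  apply: E'X; apply: (EM).
    apply: (EV); apply: KE; rewrite mulnC expgM.
    elim: k {kp} => // n IHn; rewrite expgS; apply: (KM) => //; exact: HX.
  rewrite -(mulKVg z^-1 (_ ^ _)) -commgEl; apply: (EM); first exact: EV.
  by apply: KE; apply: (HR); apply: (HV); [exact: EH|exact: HXn].
have E'1 : E' 1 by have := E'X 0%N 1 E1; rewrite mulg1.
exists [set a ^+ z.1 * z.2 | z in `I_p `*` D], E'; split.
- by apply/finite_image/finite_setX => //; apply: finite_II.
- split=> //; apply: closed_bigcup; first exact: finite_II.
  by move=> k _; apply: closed_left_coset.
split.
- by move=> x Kx; have := E'X 0%N x (KE _ Kx); rewrite mul1g.
- by move=> _ [k _ [z Ez <-]]; apply: (HM); [exact: HXn|exact: EH].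
- move=> x; rewrite inE => /predU1P[->|/sub xE].
    by apply/mem_set; have := E'X 1%N 1 E1; rewrite mulg1 expg1.
  by apply/mem_set; have := E'X 0%N x (set_mem xE); rewrite mul1g.
move=> _ [k kp [z Ez <-]]; have [d Dd Kd] := ED _ Ez.
exists (a ^+ k * d); first by exists (k, d).
by rewrite invMg -mulgA mulKg.
Qed.

(** An open [Z i] is finitely generated by Schreier's lemma, so its elementary abelian quotient by
    [Z i.+1] is finite; a closed subgroup of finite index is open. *)
Lemma zassenhaus_open (p : nat) i : prime p -> hausdorff_space G ->
  finitely_generated G -> open (zassenhaus p G i).
Proof.
move=> p_pr hG fgG.
have Zs j := zassenhaus_subgroup p_pr cG hG j.
elim: i => [|i IH]; first exact: openT.
case: (posnP i) => [->|i0]; first exact: openT.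
have [B finB genB] := open_subgroup_fg (Zs i).1 IH fgG.
have [D finD HD] : exists2 D, finite_set D & forall x, zassenhaus p G i x ->
    exists2 d, D d & zassenhaus p G i.+1 (d^-1 * x).
  apply: (finite_cover_quotient (prime_gt0 p_pr) (Zs i) (Zs i.+1)) finB genB.
  - exact: zassenhausS.
  - move=> x y Zx Zy; apply: (zassenhaus_anti p_pr cG hG (_ : i.+1 <= i + i)%N); first by lia.
    exact: zassenhaus_commg.
  - move=> x Zx; apply: (zassenhaus_anti p_pr cG hG (_ : i.+1 <= p * i)%N).
      by have := prime_gt1 p_pr; nia.
    exact: zassenhausX.
apply: finite_cosets_open; [exact: (Zs _).2|exact: (Zs _).1|].
have fin := open_cosets_finite cG IH (Zs i).1.
pose f (z : set G * G) : set G := [set xget 1 z.1 * z.2 * y | y in zassenhaus p G i.+1].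
apply: (@sub_finite_set _ _ (f @` (left_cosets setT (zassenhaus p G i) `*` D))); last first.
  by apply/finite_image/finite_setX.
move=> _ [x _ <-]; set C := [set x * y | y in zassenhaus p G i].
have Cx : C x by exists 1; [case: (Zs i) => -[]|rewrite mulg1].
have [z Zz E] : C (xget 1 C) by apply: xgetPex; exists x.
have [d Dd Kd] : exists2 d, D d & zassenhaus p G i.+1 (d^-1 * z^-1).
  by apply: HD; case: (Zs i) => -[_ _ ZV] _; apply: (ZV).
exists (C, d); first by split=> //; exists x.
rewrite /f /= -E; apply/left_coset_eqP; first exact: (Zs _).1.
by rewrite !invMg -!mulgA mulVg mulg1.
Qed.

Lemma zassenhaus_open_normal (p : nat) i : prime p -> hausdorff_space G ->
  finitely_generated G -> open_normal_subgroup (zassenhaus p G i).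
Proof.
move=> p_pr hG fgG; split; first exact: (zassenhaus_subgroup p_pr cG hG i).1.
- exact: zassenhaus_open.
- exact: zassenhaus_conj.
Qed.
End Openness.

(** * Free pro-p groups *)

Lemma finite_quotient_onto (G : topGroupType) (N : set G) :
  compact [set: G] -> open_normal_subgroup N ->
  exists (hT : finGroupType) (pi : G -> hT), [/\ {morph pi : x y / x * y},
    (forall x, pi x = 1 <-> N x) & forall s, exists x, pi x = s].
Proof.
move=> cG oN; have [hT [pi [piM kerpi]]] := finite_quotient cG oN.
have sT : subgroup [set: G] by [].
pose H := Group (quot_image_group_set piM sT).
have piH x : pi x \in H by apply: quot_image_in.
exists (subg_of H), (fun x => subg H (pi x)); split.
- by move=> x y; rewrite piM morphM.
- move=> x; rewrite -kerpi; split=> [|->]; last by rewrite morph1.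
  by move=> E; rewrite -(@subgK _ H _ (piH x)) E.
- move=> s; have /mem_quot_image[x _ E] := subgP s.
  by exists x; rewrite E sgvalK.
Qed.

(** An alias that carries the discrete topology, so that finite p-groups can be targets of the
    universal property. *)
Definition discrete_group (gT : finGroupType) : Type := gT.
HB.instance Definition _ (gT : finGroupType) := FinGroup.on (discrete_group gT).
HB.instance Definition _ (gT : finGroupType) :=
  hasNbhs.Build (discrete_group gT) principal_filter.
HB.instance Definition _ (gT : finGroupType) :=
  Discrete_ofNbhs.Build (discrete_group gT) erefl.

Section DiscreteGroup.
Variable gT : finGroupType.
Notation D := (discrete_group gT).

Lemma discrete_mulg_continuous : continuous (fun z : D * D => z.1 * z.2).
Proof.
move=> [x y] /= U /principal_filterP Uxy.
exists ([set x], [set y]) => /=; first by split; apply/principal_filterP.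
by move=> [a b] /= [-> ->].
Qed.

Lemma discrete_invg_continuous : continuous (fun x : D => x^-1).
Proof. by apply/continuousP => A _; apply: discrete_open. Qed.

HB.instance Definition _ :=
  isTopGroup.Build D discrete_mulg_continuous discrete_invg_continuous.

Lemma discrete_pro_p (p : nat) : p.-group [set: gT]%SET -> pro_p D p.
Proof.
move=> pgT; split.
- exact/finite_compact/finite_finset.
- exact: discrete_hausdorff.
- exact/zero_dimension_totally_disconnected/discrete_zero_dimension.
move=> N oN; have cD : compact [set: D] by exact/finite_compact/finite_finset.
have [hT [pi [piM kerpi onto]]] := finite_quotient_onto cD oN.
have NT : [set: D] = mulset setT N.
  by apply/seteqP; split=> // x _; apply: subset_mulsetl => //; case: oN => -[].
rewrite NT (group_index_quot piM kerpi); last by case: oN.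
have piM' : {in [set: gT]%SET &, {morph pi : x y / x * y}} by move=> x y _ _; apply: piM.
have -> : quot_image pi setT = Morphism piM' @* [set: gT]%SET.
  apply/setP => s; apply/idP/idP => [_|_]; last first.
    by have [x <-] := onto s; apply: quot_image_in.
  by have [x <-] := onto s; apply/morphimP; exists x; rewrite ?inE.
have /p_natP[k E] := morphim_pgroup (Morphism piM') pgT.
by exists k.
Qed.
End DiscreteGroup.

Section FreeProP.
Variables (p : nat) (F : topGroupType) (X : Type) (b : X -> F).
Hypothesis p_pr : prime p.
Hypothesis freeF : free_pro_p_on p b.

Lemma free_hom (gT : finGroupType) (f : X -> gT) :
  p.-group [set: gT]%SET -> finite_set [set x | f x <> 1] ->
  exists phi : F -> gT, [/\ {morph phi : x y / x * y},
    forall S : set gT, open [set x | S (phi x)] & forall x, phi (b x) = f x].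
Proof.
move=> pgT fin; have [_ _ /(_ (discrete_group gT) f)] := freeF.
case; first exact: discrete_pro_p.
  move=> U U1; apply: sub_finite_set fin => x nU fx1; apply: nU.
  by rewrite fx1; exact: nbhs_singleton U1.
move=> phi [[phiM cphi phib] _]; exists phi; split=> // S.
apply: (@open_preimage F (discrete_group gT) phi S cphi); exact: discrete_open.
Qed.

Lemma free_hom_uniq (gT : finGroupType) (phi psi : F -> gT) :
  p.-group [set: gT]%SET ->
  {morph phi : x y / x * y} -> (forall S : set gT, open [set x | S (phi x)]) ->
  {morph psi : x y / x * y} -> (forall S : set gT, open [set x | S (psi x)]) ->
  (forall x, phi (b x) = psi (b x)) -> phi = psi.
Proof.
move=> pgT phiM ophi psiM opsi E; have [_ bcv univ] := freeF.
have phi1 : phi 1 = 1 by apply: (mulgI (phi 1)); rewrite -phiM !mulg1.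
have /(_ _)[||chi [_ uniq]] := univ (discrete_group gT) (phi \o b).
- exact: discrete_pro_p.
- move=> U U1; apply: (bcv [set x | U (phi x)]).
  by apply: open_nbhs_nbhs; split; [exact: ophi|rewrite /= phi1; exact: nbhs_singleton U1].
have phiE : chi = phi.
  by apply: uniq; split=> //; apply/continuousP => S _; apply: ophi.
have psiE : chi = psi.
  apply: uniq; split=> // [|x]; last by rewrite -E.
  by apply/continuousP => S _; apply: opsi.
by rewrite -phiE.
Qed.

(** By uniqueness in the universal property, conjugation by an element that centralizes the basis is
    the identity. This applies first to the basis element, then to every [v], which now commutes
    with it. *)
Lemma subsingleton_basis_commute : (forall x y : X, x = y) -> forall u v : F, commute u v.
Proof.
move=> X1; have [proF bcv univ] := freeF.
have [chi [_ uniq]] := univ F b proF bcv.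
have central a : (forall x, b x ^ a = b x) -> forall u, u ^ a = u.
  move=> ab u; have -> : u ^ a = chi u.
    suff -> : chi = (fun u => u ^ a) by [].
    apply: uniq; split=> // [v w|]; first exact: conjMg.
    by apply: continuous_conjg; [move=> ?; apply: cvg_id|exact: cst_continuous].
  suff -> : chi = (fun u => u) by [].
  by apply: uniq; split=> // ?; apply: cvg_id.
have b_central x u : u ^ b x = u.
  by apply: central => y; rewrite (X1 y x) /conjg mulKg.
move=> u v; have : u ^ v = u.
  apply: central => x; rewrite /conjg.
  have <- : v * b x = b x * v by rewrite -{2}(b_central x v) /conjg mulKVg.
  by rewrite mulKg.
by move=> E; rewrite /commute -{2}E /conjg mulKVg.
Qed.

(** Otherwise the images of the basis lie in a maximal subgroup [M], which is normal in a p-group.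
    The map to the quotient by [M] is trivial on the basis, hence trivial by uniqueness, against
    surjectivity. *)
Lemma free_generates (N : set F) (gT : finGroupType) (pi : F -> gT) :
  open_normal_subgroup N -> {morph pi : x y / x * y} ->
  (forall x, pi x = 1 <-> N x) -> (forall s, exists x, pi x = s) ->
  p.-group [set: gT]%SET /\ <<quot_image pi (range b)>> = [set: gT]%SET.
Proof.
move=> oN piM kerpi onto; have [[_ _ _ indexF] bcv _] := freeF.
have sN : subgroup N by case: oN.
have [N1 _ _] := sN.
have imT : quot_image pi setT = [set: gT]%SET.
  by apply/setP => s; rewrite [RHS]inE; have [x <-] := onto s; rewrite quot_image_in.
have pgT : p.-group [set: gT]%SET.
  have [k] := indexF _ oN; rewrite (_ : [set: F] = mulset setT N).
    by rewrite (group_index_quot piM kerpi) // imT => E; rewrite /pgroup E pnatX pnat_id ?orbT.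
  by apply/seteqP; split=> // x _; apply: subset_mulsetl.
split=> //; apply/eqP; rewrite eqEproper finset.subsetT /=; apply/negP => properM.
have [M /maxgroupP[Mproper Mmax] sM] := @maxgroup_exists _
  (fun A => A \proper [set: gT]%SET) _ properM.
have maxM : maximal M [set: gT]%SET by apply/maxgroupP.
have nM : normal M [set: gT]%SET := p_maximal_normal pgT maxM.
have nM' x : x \in 'N(M) by apply: (fintype.subsetP (normal_norm nM)); rewrite inE.
pose phi x := coset M (pi x).
have phiM : {morph phi : x y / x * y}.
  by move=> x y; rewrite /phi piM morphM.
have opi (S : set gT) : open [set x | S (pi x)].
  rewrite (_ : [set x | _] = \bigcup_(x in [set x | S (pi x)]) [set x * y | y in N]).
    by apply: bigcup_open => x _; apply: open_left_coset; case: oN.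
  apply/seteqP; split=> [x Sx|_ [x Sx [y /kerpi Ny <-]]] /=.
    by exists x => //; exists 1 => //; rewrite mulg1.
  by rewrite piM Ny mulg1.
have pQ : p.-group [set: coset_of M]%SET.
  have -> : [set: coset_of M]%SET = [set: gT]%SET / M.
    apply/setP => s; rewrite inE; have [y yN ->] := cosetP s.
    by rewrite mem_quotient // inE.
  exact: quotient_pgroup.
have phi1 : phi = fun=> 1.
  apply: (free_hom_uniq pQ phiM) => //.
  - by move=> S; apply: (opi [set s | S (coset M s)]).
  - by move=> x y; rewrite mulg1.
  - move=> S; have [S1|S1] := pselect (S 1).
      by have -> : [set x : F | S 1] = setT; [apply/seteqP; split|exact: openT].
    by have -> : [set x : F | S 1] = set0; [apply/seteqP; split|exact: open0].
  move=> x; apply/coset_id/(fintype.subsetP sM)/mem_gen/quot_image_in.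
  by exists x.
case/negP: (proper_subn Mproper); apply/fintype.subsetP => s _.
have [x <-] := onto s; have := congr1 (fun f => f x) phi1; rewrite /phi.
by move/coset_idr; apply.
Qed.

(** Prescribing values on [k] basis elements yields [p ^ k] homomorphisms to ['F_p], and each is
    determined by its values on [s]. *)
Lemma basis_bound (s : seq F) k (h : 'I_k -> X) :
  topgen [set` s] = [set: F] -> injective h -> (k <= size s)%N.
Proof.
move=> gens hinj.
have pFp : p.-group [set: 'F_p]%SET by rewrite /pgroup cardsT card_Fp // pnat_id.
(* Here [1] is the neutral element of the additive group of ['F_p]. *)
pose f (c : {ffun 'I_k -> 'F_p}) x : 'F_p :=
  if [pick i | `[< h i = x >]] is Some i then c i else 1.
have fh c i : f c (h i) = c i.
  rewrite /f; case: pickP => [j /asboolP/hinj -> //|/(_ i)].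
  by rewrite asboolT.
have finf c : finite_set [set x | f c x <> 1].
  apply: (@sub_finite_set _ _ (range h)); last exact/finite_image/finite_finset.
  move=> x /=; rewrite /f; case: pickP => [j /asboolP <- _|] //.
  by exists j.
have [phi phiP] := choice (fun c => free_hom pFp (finf c)).
pose Phi c := [ffun j : 'I_(size s) => phi c (nth 1 s j)].
suff Phi_inj : injective Phi.
  have := leq_card _ Phi_inj; rewrite !card_ffun (card_Fp p_pr) !card_ord.
  by rewrite leq_exp2l // prime_gt1.
move=> c c' E; have [phiM ophi phib] := phiP c; have [phiM' ophi' phib'] := phiP c'.
suff same x : phi c x = phi c' x.
  by apply/ffunP => i; rewrite -!fh -phib -phib' same.
have one (psi : F -> 'F_p) : {morph psi : x y / x * y} -> psi 1 = 1.
  by move=> psiM; apply: (mulgI (psi 1)); rewrite -psiM !mulg1.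
have : topgen [set` s] `<=` [set x | phi c x = phi c' x].
  apply: topgen_sub; last first.
    move=> y /= ys; have ys' := ys; rewrite -index_mem in ys'.
    have := congr1 (fun g : {ffun _} => g (Ordinal ys')) E.
    by rewrite !ffunE /= nth_index.
  split.
    split=> [|u v /= Ex Ey|u /= Ex] /=; first by rewrite !one.
      by rewrite phiM phiM' Ex Ey.
    apply: (mulgI (phi c u)); rewrite -phiM mulgV Ex -phiM' mulgV.
    by rewrite !one.
  rewrite -openC (_ : ~` _ = \bigcup_(z in [set z : 'F_p * 'F_p | z.1 <> z.2])
      ([set x | phi c x = z.1] `&` [set x | phi c' x = z.2])).
    apply: bigcup_open => z _; apply: openI.
      exact: (ophi [set t | t = z.1]).
    exact: (ophi' [set t | t = z.2]).
  apply/seteqP; split=> [y nE|y [[t t'] /= tt' [-> ->]] //].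
  by exists (phi c y, phi c' y).
by rewrite gens; apply.
Qed.
End FreeProP.

(** By [basis_bound] there is a largest [k] with an injection [h] from ['I_k] to the index type; it
    is onto, and [k >= 2] as [F] is not abelian. The two conclusions are the form in which freeness
    is used later. *)
Theorem finite_free_basis (p : nat) (F : topGroupType) :
  prime p -> free_pro_p p F -> finitely_generated F -> nonabelian F ->
  exists d (c : 'I_d.+2 -> F),
  (forall (gT : finGroupType) (f : 'I_d.+2 -> gT), p.-group [set: gT]%SET ->
    exists phi : F -> gT, [/\ {morph phi : x y / x * y},
      forall S : set gT, open [set x | S (phi x)] & forall i, phi (c i) = f i]) /\
  (forall (N : set F) (gT : finGroupType) (pi : F -> gT),
    open_normal_subgroup N -> {morph pi : x y / x * y} ->
    (forall x, pi x = 1 <-> N x) -> (forall s, exists x, pi x = s) ->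
    p.-group [set: gT]%SET /\ <<[set pi (c i) | i : 'I_d.+2]%SET>> = [set: gT]%SET).
Proof.
move=> p_pr [X [b freeF]] [A [/finite_seqP[s ->] gens]] nab.
pose P k := `[< exists h : 'I_k -> X, injective h >].
have P0 : exists k, P k.
  by exists 0%N; apply/asboolP; exists (fun i : 'I_0 => False_rect X (notF (ltn_ord i))) => -[].
have bound k : P k -> (k <= size s)%N.
  by move=> /asboolP[h /(basis_bound p_pr freeF gens)].
case: (ex_maxnP P0 bound) => k /asboolP[h hinj] kmax.
have hsurj x : exists i, h i = x.
  apply: contrapT => nx; suff /kmax : P k.+1 by rewrite ltnn.
  apply/asboolP; exists (fun i => if unlift ord_max i is Some j then h j else x) => i j.
  case: unliftP => [i' ->|->]; case: unliftP => [j' ->|->] //.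
  - by move/hinj ->.
  - by move=> E; case: nx; exists i'.
  - by move=> E; case: nx; exists j'.
have k2 : (1 < k)%N.
  rewrite ltnNge; apply/negP => k1; apply: nab; apply: (subsingleton_basis_commute freeF).
  move=> x y; have [i <-] := hsurj x; have [j <-] := hsurj y; congr h.
  by apply: val_inj => /=; have := ltn_ord i; have := ltn_ord j; move: k1; clear; lia.
case: k h hinj kmax hsurj k2 => [|[|d]] // h hinj _ hsurj _.
exists d, (b \o h); split=> [gT f pgT|N gT pi oN piM kerpi onto].
  have [g gh] : exists g, cancel h g.
    have [g gP] := choice hsurj; exists g => i.
    by apply: hinj; rewrite gP.
  have hg x : h (g x) = x by have [i <-] := hsurj x; rewrite gh.
  have [|phi [phiM ophi phib]] := free_hom freeF (f := f \o g) pgT.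
    apply: (@sub_finite_set _ _ (range h)); last exact/finite_image/finite_finset.
    by move=> x _; exists (g x).
  by exists phi; split=> // i; rewrite /= phib /= gh.
have [pgT gen] := free_generates p_pr freeF oN piM kerpi onto.
split=> //; rewrite -gen; congr <<_>>; apply/setP => t; apply/imsetP/idP.
  by move=> [i _ ->]; apply: quot_image_in; exists (h i).
move/mem_quot_image => [_ [x _ <-] <-]; have [i <-] := hsurj x.
by exists i.
Qed.

Section GeneratedSubgroup.
Variable G : topGroupType.
Implicit Types A H : set G.

(** Abstract generation without closure, so that every element of the Engel union already lies in a
    finite stage. *)
Definition sgen A : set G := smallest (@subgroup G) A.

Lemma sgen_subgroup A : subgroup (sgen A).
Proof.
split=> [H [[] //]|x y Ax Ay H HA|x Ax H HA].
- by have [[_ HM _] _] := HA; apply: HM; [apply: Ax|apply: Ay].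
- by have [[_ _ HV] _] := HA; apply: HV; apply: Ax.
Qed.

Lemma sgen_sub A H : subgroup H -> A `<=` H -> sgen A `<=` H.
Proof. exact: smallest_sub. Qed.

Lemma mem_sgen A x : A x -> sgen A x.
Proof. exact: sub_gen_smallest. Qed.
End GeneratedSubgroup.

(** * Indices of subgroups modulo the Zassenhaus series *)

Section ZassenhausIndex.
Variables (p : nat) (F : topGroupType).
Hypothesis p_pr : prime p.
Hypothesis cF : compact [set: F].
Hypothesis hF : hausdorff_space F.
Hypothesis fgF : finitely_generated F.
Implicit Types (H K : set F).

Notation Z := (zassenhaus p F).

Definition zindex n H : nat := group_index (mulset H (Z n)) (Z n).

Let Zsub n : subgroup (Z n). Proof. exact: (zassenhaus_subgroup p_pr cF hF n).1. Qed.
Let Zconj n : conj_stable (Z n). Proof. exact: zassenhaus_conj. Qed.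
Let Zopen n : open_normal_subgroup (Z n). Proof. exact: zassenhaus_open_normal. Qed.

Lemma zquotient n : exists (gT : finGroupType) (pi : F -> gT),
  [/\ {morph pi : x y / x * y}, (forall x, pi x = 1 <-> Z n x) &
      forall s, exists x, pi x = s].
Proof. exact: finite_quotient_onto. Qed.

Lemma zindexE n H (gT : finGroupType) (pi : F -> gT) :
  {morph pi : x y / x * y} -> (forall x, pi x = 1 <-> Z n x) ->
  zindex n H = #|quot_image pi H|.
Proof. by move=> piM kerpi; rewrite /zindex (group_index_quot piM kerpi). Qed.

Lemma quot_imageS (gT : finGroupType) (pi : F -> gT) H K :
  H `<=` K -> (quot_image pi H \subset quot_image pi K)%N.
Proof.
move=> HK; apply/fintype.subsetP => s /mem_quot_image[h /HK Kh <-].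
exact: quot_image_in.
Qed.

Lemma zindex_gt0 n H : subgroup H -> (0 < zindex n H)%N.
Proof.
move=> [H1 _ _]; have [gT [pi [piM kerpi _]]] := zquotient n.
by rewrite (zindexE H piM kerpi); apply/card_gt0P; exists (pi 1); apply: quot_image_in.
Qed.

Lemma zindex_mono n H K : H `<=` K -> (zindex n H <= zindex n K)%N.
Proof.
move=> HK; have [gT [pi [piM kerpi _]]] := zquotient n.
by rewrite !(zindexE _ piM kerpi) subset_leq_card // quot_imageS.
Qed.

Lemma zindex_le_mulset n H K : H `<=` mulset K (Z n) -> (zindex n H <= zindex n K)%N.
Proof.
move=> HK; apply: leq_trans (zindex_mono n HK) _.
have [gT [pi [piM kerpi _]]] := zquotient n.
by rewrite !(zindexE _ piM kerpi) quot_image_mulset.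
Qed.

Lemma quot_image_sgen (gT : finGroupType) (pi : F -> gT) (A : set F) (B : {group gT}) :
  {morph pi : x y / x * y} -> (forall a, A a -> pi a \in B) ->
  quot_image pi (sgen A) \subset B.
Proof.
move=> piM AB; apply/fintype.subsetP => s /mem_quot_image[h + <-].
suff : sgen A `<=` [set h | pi h \in B] by apply.
apply: sgen_sub => //; split=> [|x y /= xB yB|x /= xB].
- by rewrite /= (quot1 piM) group1.
- by rewrite piM groupM.
- by rewrite (quotV piM) groupV.
Qed.

(** The images of the [Z i] in [F / Z n] form an N_p-series that is trivial at [n], so [card_gen_le]
    applies. *)
Lemma zindex_sgen_le n (I : finType) (s : I -> F) (wt : I -> nat) :
  (forall i, (0 < wt i)%N) -> (forall i, Z (wt i) (s i)) ->
  (zindex n (sgen (range s)) <= p ^ size (light_words wt n))%N.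
Proof.
move=> wt_gt0 Zs; have [gT [pi [piM kerpi _]]] := zquotient n.
rewrite (zindexE _ piM kerpi).
pose P i := Group (quot_image_group_set piM (Zsub i)).
have npP : np_series p P.
  split.
  - by move=> i; apply/quot_imageS/zassenhausS.
  - move=> i j _ _ /mem_quot_image[x Zx <-] /mem_quot_image[y Zy <-].
    by rewrite -(quotR piM); apply/quot_image_in/zassenhaus_commg.
  - move=> i _ /mem_quot_image[x Zx <-].
    by rewrite -(quotX piM); apply/quot_image_in/zassenhausX.
have Pn : P n = 1%G.
  apply/group_inj/setP => t; apply/idP/set1P => [/mem_quot_image[x /kerpi Zx <-] //|->].
  exact: group1.
have sP i : pi (s i) \in P (wt i) by apply: quot_image_in.
apply: leq_trans (card_gen_le p_pr npP Pn wt_gt0 sP).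
apply: subset_leq_card; apply: (quot_image_sgen (B := <<_>>%G) piM) => _ [i _ <-].
exact/mem_gen/imset_f.
Qed.

(** Lagrange for the image of [H] in [F / Z n.+1] and its intersection with the normal subgroup
    [Z n / Z n.+1]. *)
Lemma zindex_level n H (gT : finGroupType) (pi : F -> gT) :
  {morph pi : x y / x * y} -> (forall x, pi x = 1 <-> Z n.+1 x) -> subgroup H ->
  zindex n.+1 H =
    (#|quot_image pi H :&: quot_image pi (Z n)| * zindex n H)%N.
Proof.
move=> piM kerpi sH.
pose C := Group (quot_image_group_set piM (Zsub n)).
pose HH := Group (quot_image_group_set piM sH).
have piC x : pi x \in C <-> Z n x.
  split=> [/mem_quot_image[z Zz] /(quot_eqP piM kerpi) Zx|]; last exact: quot_image_in.
  have [_ ZM _] := Zsub n; rewrite -(mulKVg z x); apply: (ZM) => //.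
  exact: zassenhausS.
have pi_norm x : pi x \in 'N(C).
  rewrite inE; apply/fintype.subsetP => _ /imsetP[_ /mem_quot_image[z Zz <-] ->].
  by rewrite /conjg -(quotV piM) -!piM; apply/quot_image_in/Zconj.
pose rho x := coset C (pi x).
have rhoM : {morph rho : x y / x * y} by move=> x y; rewrite /rho piM morphM.
have kerrho x : rho x = 1 <-> Z n x.
  rewrite -piC; split=> [/coset_idr E|/coset_id //]; exact: E.
have HN : HH \subset 'N(C).
  by apply/fintype.subsetP => _ /mem_quot_image[h _ <-].
have -> : zindex n H = #|HH / C|.
  rewrite (zindexE H rhoM kerrho); apply: eq_card => s; apply/idP/idP.
    by move=> /mem_quot_image[h Hh <-]; apply/mem_quotient/quot_image_in.
  move=> /morphimP[_ _ /mem_quot_image[h Hh <-] ->].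
  by apply/mem_quot_image; exists h.
by rewrite (zindexE H piM kerpi) card_quotient //; apply/esym/(LagrangeI HH C).
Qed.

Lemma zindexS n H : subgroup H -> (zindex n H <= zindex n.+1 H)%N.
Proof.
move=> sH; have [gT [pi [piM kerpi _]]] := zquotient n.+1.
rewrite (zindex_level piM kerpi sH) leq_pmull //.
apply/card_gt0P; exists (pi 1); rewrite inE !quot_image_in //; first by case: (Zsub n).
by case: sH.
Qed.

(** [D] and [K] have the same trace on [Z n / Z n.+1], so both indices grow by the same factor in
    [zindex_level]. *)
Lemma zindex_exhausted n D K : subgroup D -> subgroup K -> K `<=` D ->
  D `&` Z n `<=` mulset K (Z n.+1) ->
  (zindex n.+1 D * zindex n K = zindex n D * zindex n.+1 K)%N.
Proof.
move=> sD sK KD DK; have [gT [pi [piM kerpi _]]] := zquotient n.+1.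
rewrite (zindex_level piM kerpi sD) (zindex_level piM kerpi sK).
have -> : quot_image pi D :&: quot_image pi (Z n) = quot_image pi K :&: quot_image pi (Z n).
  apply/setP => s; rewrite !inE; apply/andP/andP => -[/asboolP sDs /asboolP sZ]; last first.
    split; apply/asboolP => //; have [k Kk E] := sDs; exists k => //; exact: KD.
  split; apply/asboolP => //; have [x Dx E] := sDs; have [z Zz E'] := sZ.
  have Zx : Z n x.
    have [_ ZM _] := Zsub n; rewrite -(mulKVg z x); apply: (ZM) => //.
    by apply: zassenhausS => //; apply/(quot_eqP piM kerpi); rewrite E.
  have [k Kk [u /kerpi Zu Ex]] := DK x (conj Dx Zx).
  by exists k => //; rewrite -E -Ex piM Zu mulg1.
by rewrite mulnAC [RHS]mulnC mulnAC [RHS]mulnAC; nia.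
Qed.

(** [Z n / Z n.+1] is central in [F / Z n.+1] and of exponent dividing p, hence the factor of at
    most [p]. *)
Lemma zindex_adjoin n K z : subgroup K -> Z n z ->
  let K' := sgen (K `|` [set z]) in
  [/\ K' `<=` mulset K (Z n), (zindex n.+1 K' <= p * zindex n.+1 K)%N &
      ~ mulset K (Z n.+1) z -> (zindex n.+1 K < zindex n.+1 K')%N].
Proof.
move=> sK Zz K'; have [gT [pi [piM kerpi _]]] := zquotient n.+1.
pose KK := Group (quot_image_group_set piM sK).
have KK' : K `<=` K' by move=> x Kx; apply: mem_sgen; left.
have K'z : K' z by apply: mem_sgen; right.
have sK' : subgroup K' by apply: sgen_subgroup.
split.
- apply: sgen_sub; first exact: mulset_subgroup.
  move=> x [Kx|->]; first by apply: subset_mulsetl => //; case: (Zsub n).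
  by apply: subset_mulsetr => //; have [] := sK.
- have zp : pi z ^+ p = 1.
    rewrite -(quotX piM); apply/kerpi; case: (posnP n) => [->//|n0].
    apply: (zassenhaus_anti p_pr cF hF (_ : n.+1 <= p * n)%N).
      by have := prime_gt1 p_pr; nia.
    exact: zassenhausX.
  have zcent : KK \subset 'C(<[pi z]>).
    rewrite cent_cycle; apply/fintype.subsetP => _ /mem_quot_image[k Kk <-].
    apply/cent1P/esym; apply/commgP; rewrite -(quotR piM); apply/eqP/kerpi.
    by rewrite -addn1; apply: zassenhaus_commg.
  rewrite !(zindexE _ piM kerpi) mulnC.
  apply: leq_trans (_ : #|KK <*> <[pi z]>| <= _)%N.
    apply: subset_leq_card; apply: (quot_image_sgen (B := _ <*> _)%G piM) => x [Kx|->] /=.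
      by apply: (fintype.subsetP (joing_subl _ _)); apply: quot_image_in.
    by apply: (fintype.subsetP (joing_subr _ _)); apply: cycle_id.
  rewrite norm_joinEl; last exact: cents_norm.
  apply: leq_trans (_ : #|KK| * #|<[pi z]>| <= _)%N.
    by rewrite mul_cardG leq_pmulr // cardG_gt0.
  rewrite leq_mul2l; apply/orP; right; apply: dvdn_leq; first exact: prime_gt0.
  by rewrite -[#|_|]/#[pi z] order_dvdn zp.
move=> nKz; rewrite !(zindexE _ piM kerpi); apply: proper_card.
rewrite properE quot_imageS //=; apply/negP => /fintype.subsetP /(_ (pi z)).
rewrite quot_image_in // => /(_ isT)/mem_quot_image[k Kk /(quot_eqP piM kerpi) Zkz].
by apply: nKz; exists k => //; exists (k^-1 * z) => //; rewrite mulKVg.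
Qed.
End ZassenhausIndex.

(** * Lower bound for the index of the series, and Engel commutators *)

Section Basis.
Variables (p : nat) (F : topGroupType) (d : nat) (c : 'I_d.+2 -> F).
Hypothesis p_pr : prime p.
Hypothesis cF : compact [set: F].
Hypothesis hF : hausdorff_space F.
Hypothesis fgF : finitely_generated F.
Hypothesis c_hom : forall (gT : finGroupType) (f : 'I_d.+2 -> gT),
  p.-group [set: gT]%SET ->
  exists phi : F -> gT, [/\ {morph phi : x y / x * y},
    forall S : set gT, open [set x | S (phi x)] & forall i, phi (c i) = f i].
Hypothesis c_gen : forall (N : set F) (gT : finGroupType) (pi : F -> gT),
  open_normal_subgroup N -> {morph pi : x y / x * y} ->
  (forall x, pi x = 1 <-> N x) -> (forall s, exists x, pi x = s) ->
  p.-group [set: gT]%SET /\ <<[set pi (c i) | i : 'I_d.+2]%SET>> = [set: gT]%SET.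

Notation Z := (zassenhaus p F).
Notation zindex := (zindex p).

(** The homomorphism sending the basis to the elements [f i] maps [Z n] into [P n = 1], so it
    factors through [F / Z n], which is therefore at least as large as the subgroup they
    generate. *)
Lemma zindex_lower Q e l : Q.+1 = (p ^ e)%N ->
  (p ^ count (run_free (ord0 : 'I_d.+2) Q Q) (words 'I_d.+2 l) <= zindex (Q.+3 + l) [set: F])%N.
Proof.
move=> qE; have xy : ord_max != ord0 :> 'I_d.+2 by [].
have [gT [P [f [npP Pn pgP fP cardG]]]] := large_np_quotient l p_pr qE xy.
(* The universal property wants a p-group as a whole type, hence the passage to [subg_of]. *)
have pgS : p.-group [set: subg_of (P 1%N)]%SET.
  by rewrite /pgroup -(card_isog (isog_subg _)).
have [phi' [phiM' ophi' phic']] := c_hom (fun i => subg (P 1%N) (f i)) pgS.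
pose phi x := sgval (phi' x).
have phiM : {morph phi : x y / x * y} by move=> x y; rewrite /phi phiM'.
have ophi (S : set gT) : open [set x | S (phi x)].
  exact: (ophi' [set s | S (sgval s)]).
have phiP x : phi x \in P 1%N by apply: subgP.
have phic i : phi (c i) = f i by rewrite /phi phic' subgK.
have phiZ : forall i x, Z i x -> phi x \in P i.
  apply: (zassenhaus_np_series p_pr npP phiM phiP) => i.
  rewrite -openC; exact: (ophi (~` [set s | s \in P i])).
apply: leq_trans cardG _.
set n := (Q.+3 + l)%N in Pn *.
have [hT [pi [piM kerpi onto]]] := zquotient p_pr cF hF fgF n.
rewrite (zindexE p_pr cF hF _ piM kerpi).
have [rep repP] := choice onto.
apply: leq_trans (_ : #|[set phi (rep s) | s in quot_image pi setT]%SET| <= _)%N; last exact: leq_imset_card.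
apply: subset_leq_card.
apply: fintype.subset_trans (_ : <<[set f c0 | c0 : 'I_d.+2]%SET>> \subset quot_image phi setT) _.
  have sT : subgroup [set: F] by [].
  rewrite -[quot_image phi setT]/(gval (Group (quot_image_group_set phiM sT))) gen_subG.
  by apply/fintype.subsetP => _ /imsetP[i _ ->]; rewrite -phic; apply: quot_image_in.
apply/fintype.subsetP => _ /mem_quot_image[x _ <-].
apply/imsetP; exists (pi x); first exact: quot_image_in.
have /(quot_eqP piM kerpi)/phiZ : pi (rep (pi x)) = pi x by rewrite repP.
rewrite Pn inE phiM (quotV phiM) => /eqP E.
by apply: (mulgI (phi (rep (pi x)))^-1); rewrite E mulVg.
Qed.

Fixpoint engel (k : 'I_d.+1) (j : nat) : F :=
  if j is j'.+1 then [~ engel k j', c ord0] else c (lift ord0 k).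

Lemma engel_deg k j : Z j.+1 (engel k j).
Proof.
elim: j => [//|j IH] /=.
by rewrite -addn1; apply: zassenhaus_commg.
Qed.

Definition engel_group (m : nat) : set F :=
  sgen (range (fun jk : 'I_m.+1 * 'I_d.+1 => engel jk.2 jk.1)).

Definition engel_union : set F :=
  sgen (range (fun jk : nat * 'I_d.+1 => engel jk.2 jk.1)).

Lemma engel_group_sub m m' : (m <= m')%N -> engel_group m `<=` engel_group m'.
Proof.
move=> mm; apply: sgen_sub; first exact: sgen_subgroup.
move=> _ [[j k] _ <-] /=; apply: mem_sgen.
have jm : (j < m'.+1)%N by apply: leq_trans (ltn_ord j) _.
by exists (Ordinal jm, k).
Qed.

Lemma engel_group_union m : engel_group m `<=` engel_union.
Proof.
apply: sgen_sub; first exact: sgen_subgroup.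
by move=> _ [[j k] _ <-] /=; apply: mem_sgen; exists (j : nat, k).
Qed.

Lemma engel_union_group x : engel_union x -> exists m, engel_group m x.
Proof.
suff : engel_union `<=` [set x | exists m, engel_group m x] by apply.
apply: sgen_sub; last first.
  move=> _ [[j k] _ <-] /=; exists j; apply: mem_sgen.
  by exists (inord j, k) => //=; rewrite inordK.
split=> [|a b /= [m Ha] [m' Hb]|a /= [m Ha]] /=.
- by exists 0%N; case: (sgen_subgroup (range (fun jk : 'I_1 * 'I_d.+1 => engel jk.2 jk.1))).
- exists (maxn m m'); have [_ HM _] := sgen_subgroup
    (range (fun jk : 'I_(maxn m m').+1 * 'I_d.+1 => engel jk.2 jk.1)).
  apply: HM; [apply: engel_group_sub Ha|apply: engel_group_sub Hb].
    exact: leq_maxl.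
  exact: leq_maxr.
- exists m; have [_ _ HV] := sgen_subgroup (range (fun jk : 'I_m.+1 * 'I_d.+1 => engel jk.2 jk.1)).
  exact: HV.
Qed.

Lemma zindex_engel_group n m :
  (zindex n (engel_group m) <=
     p ^ size (light_words (fun jk : 'I_m.+1 * 'I_d.+1 => (jk.1 : nat).+1) n))%N.
Proof. by apply: zindex_sgen_le => // -[j k] /=; apply: engel_deg. Qed.

(* The first basis element normalizes [engel_union] modulo every [Z n], and its
   p^n-th power lies in [Z n]. *)
Lemma zindex_engel_union n : (zindex n [set: F] <= zindex n engel_union * p ^ n)%N.
Proof.
have [gT [pi [piM kerpi onto]]] := zquotient p_pr cF hF fgF n.
have [_ gen] := c_gen (zassenhaus_open_normal cF n p_pr hF fgF) piM kerpi onto.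
rewrite !(zindexE p_pr cF hF _ piM kerpi).
have sD : subgroup engel_union by apply: sgen_subgroup.
pose D := Group (quot_image_group_set piM sD); set x := pi (c ord0).
have Dy k j : pi (engel k j) \in D.
  by apply: quot_image_in; apply: mem_sgen; exists (j, k).
have xN : x \in 'N(D).
  rewrite inE; apply/fintype.subsetP => _ /imsetP[_ /mem_quot_image[h Dh <-] ->].
  suff : engel_union `<=` [set h | pi h ^ x \in D] by apply.
  apply: sgen_sub; last first.
    move=> _ [[j k] _ <-] /=.
    have -> : pi (engel k j) ^ x = pi (engel k j) * pi (engel k j.+1).
      by rewrite /= (quotR piM) conjg_mulR.
    exact: groupM (Dy k j) (Dy k j.+1).
  split=> [|a b /= Ha Hb|a /= Ha] /=; first by rewrite (quot1 piM) conj1g; apply: (group1 D).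
    by rewrite piM conjMg; apply: (groupM (G := D)).
  by rewrite (quotV piM) conjVg; apply: (groupVr (G := D)).
have xp : x ^+ (p ^ n) = 1.
  have Zx k : Z (p ^ k) (c ord0 ^+ (p ^ k)).
    elim: k => [|k IH]; first by rewrite expn0 expg1.
    by rewrite expnSr expgM mulnC; apply: zassenhausX.
  rewrite /x -(quotX piM); apply/kerpi; apply: zassenhaus_anti (Zx n) => //.
  by apply/ltnW/ltn_expl/prime_gt1.
apply: leq_trans (_ : #|D <*> <[x]>| <= _)%N.
  apply: subset_leq_card; apply: fintype.subset_trans (finset.subsetT _) _.
  rewrite -gen gen_subG; apply/fintype.subsetP => _ /imsetP[i _ ->].
  case: (unliftP ord0 i) => [k ->|->].
    by apply: (fintype.subsetP (joing_subl _ _)); apply: (Dy k 0%N).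
  by apply: (fintype.subsetP (joing_subr _ _)); apply: cycle_id.
rewrite norm_joinEr ?cycle_subG //.
apply: leq_trans (_ : #|D| * #|<[x]>| <= _)%N.
  by rewrite mul_cardG leq_pmulr // cardG_gt0.
rewrite leq_mul2l; apply/orP; right; apply: dvdn_leq; first by rewrite expn_gt0 prime_gt0.
by rewrite -[#|_|]/#[x] order_dvdn xp.
Qed.
End Basis.

(** * Interpolation *)

Local Close Scope group_scope.
Local Open Scope ring_scope.
Import Order.TTheory GRing.Theory Num.Theory.

(** * Lower limits of real sequences *)

Section LowerLimit.
Variables (R : realType) (u : nat -> R).
Notation ue := (fun n => (u n)%:E).

Lemma limn_einfE_sup : limn_einf ue = ereal_sup (range (einfs ue)).
Proof. by rewrite limn_einf_lim; apply/cvg_lim => //; apply: cvg_einfs_sup. Qed.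

Lemma limn_einf_fin_ge (a : R) N : (forall n, (N <= n)%N -> a <= u n) ->
  (a%:E <= limn_einf ue)%E.
Proof.
move=> au; rewrite limn_einfE_sup; apply: le_trans (_ : (einfs ue N <= _)%E).
  by apply: le_ereal_inf_tmp => _ [n /= Nn <-]; rewrite lee_fin au.
by apply: ereal_sup_ubound; exists N.
Qed.

Lemma limn_einf_fin_le (a : R) : (forall N, exists2 n, (N <= n)%N & u n <= a) ->
  (limn_einf ue <= a%:E)%E.
Proof.
move=> ua; rewrite limn_einfE_sup; apply: ge_ereal_sup => _ [N _ <-].
have [n Nn una] := ua N; apply: le_trans (_ : ((u n)%:E <= _)%E); last by rewrite lee_fin.
by apply: ereal_inf_lbound; exists n.
Qed.

Lemma limn_einf_fin_eq (a : R) :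
  (forall e, 0 < e -> exists N, forall n, (N <= n)%N -> a - e <= u n) ->
  (forall e, 0 < e -> forall N, exists2 n, (N <= n)%N & u n <= a + e) ->
  limn_einf ue = a%:E.
Proof.
move=> lo hi; apply/eqP; rewrite eq_le; apply/andP; split.
  by apply/lee_addgt0Pr => e e0; rewrite -EFinD; apply/limn_einf_fin_le/hi.
apply/lee_addgt0Pr => e e0; have [N lN] := lo e e0.
by rewrite -leeBlDr // -EFinB; apply: limn_einf_fin_ge lN.
Qed.

Lemma limn_einf_unit_interval : (forall n, 0 <= u n <= 1) ->
  exists2 r : R, 0 <= r <= 1 & limn_einf ue = r%:E.
Proof.
move=> u01; have le0 : (0%:E <= limn_einf ue)%E.
  by apply: (limn_einf_fin_ge (N := 0)) => n _; case/andP: (u01 n).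
have le1 : (limn_einf ue <= 1%:E)%E.
  by apply: limn_einf_fin_le => N; exists N => //; case/andP: (u01 N).
case E : (limn_einf ue) le0 le1 => [r| |] //; rewrite !lee_fin => r0 r1.
by exists r => //; rewrite r0.
Qed.
End LowerLimit.

(** * Construction of a subgroup of prescribed dimension *)

Section Interpolation.
Variables (R : realType) (p : nat) (F : topGroupType) (d : nat) (c : 'I_d.+2 -> F).
Hypothesis p_pr : prime p.
Hypothesis cF : compact [set: F].
Hypothesis hF : hausdorff_space F.
Hypothesis fgF : finitely_generated F.
Hypothesis c_hom : forall (gT : finGroupType) (f : 'I_d.+2 -> gT),
  (p.-group [set: gT]%SET)%g ->
  exists phi : F -> gT, [/\ {morph phi : x y / (x * y)%g},
    forall S : set gT, open [set x | S (phi x)] & forall i, phi (c i) = f i].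
Hypothesis c_gen : forall (N : set F) (gT : finGroupType) (pi : F -> gT),
  open_normal_subgroup N -> {morph pi : x y / (x * y)%g} ->
  (forall x, pi x = 1%g <-> N x) -> (forall s, exists x, pi x = s) ->
  (p.-group [set: gT]%SET)%g /\ <<[set pi (c i) | i : 'I_d.+2]%SET>>%g = [set: gT]%SET.
Implicit Types K H : set F.

Notation Z := (zassenhaus p F).
Notation D := (engel_union c).
Notation E := (engel_group c).

(** The base of the logarithm cancels in the ratios of [hdim]; a factor [p] in the index counts as
    [lnp]. *)
Definition entropy n H : R := ln (zindex p n H)%:R.
Notation h := entropy.

Let lnp : R := ln p%:R.

Let lnp_gt0 : 0 < lnp.
Proof. by rewrite ln_gt0 // ltr1n prime_gt1. Qed.

Let zi_gt0 n H : subgroup H -> 0 < (zindex p n H)%:R :> R.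
Proof. by move=> sH; rewrite ltr0n zindex_gt0. Qed.

Let sT : subgroup [set: F]. Proof. by []. Qed.
Let sD : subgroup D. Proof. exact: sgen_subgroup. Qed.
Let sE m : subgroup (E m). Proof. exact: sgen_subgroup. Qed.

Lemma entropy_le n m H K : subgroup H -> (zindex p n H <= zindex p m K)%N -> h n H <= h m K.
Proof.
move=> sH le; rewrite ler_ln ?posrE ?ler_nat // ltr0n.
  exact: zindex_gt0.
by apply: leq_trans le; apply: zindex_gt0.
Qed.

Lemma entropy_mono n H K : subgroup H -> H `<=` K -> h n H <= h n K.
Proof. by move=> sH HK; apply: entropy_le => //; apply: zindex_mono. Qed.

Lemma entropy_ge0 n H : subgroup H -> 0 <= h n H.
Proof. by move=> sH; rewrite ln_ge0 // ler1n zindex_gt0. Qed.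

(** The light words bound the entropy of [E m] from above, and the run-free words of length
    [n - Q.+3] bound that of [F] from below. The term [n%:R * lnp] is the possible gap between [F]
    and [D]. *)
Lemma entropy_engel_negligible m (B : R) : 0 <= B ->
  exists N, forall n, (N <= n)%N -> B * (h n (E m) + n%:R * lnp) <= h n [set: F].
Proof.
move=> B0; have J0 : (0 < #|'I_d.+1|)%N by rewrite card_ord.
have AJ : #|'I_d.+2|.-1 = #|'I_d.+1| by rewrite !card_ord.
have [Q [e [QE small]]] := light_words_negligible R (ord0 : 'I_d.+2) m p_pr J0 AJ.
have [N hN] := small B; exists N => n /hN[Qn le].
have p0 : 0 < p%:R :> R by rewrite ltr0n prime_gt0.
have up := zindex_engel_group c p_pr cF hF fgF n m.
have lo := zindex_lower p_pr cF hF fgF c_hom (n - Q.+3) QE.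
rewrite subnKC // in lo.
set w := size _ in up le.
set k := count _ _ in lo le.
have hE : h n (E m) <= w%:R * lnp.
  rewrite mulr_natl -lnXn // ler_ln ?posrE ?zi_gt0 ?exprn_gt0 //.
  by rewrite -natrX ler_nat.
have hk : k%:R * lnp <= h n setT.
  rewrite mulr_natl -lnXn // ler_ln ?posrE ?zi_gt0 ?exprn_gt0 //.
  by rewrite -natrX ler_nat.
apply: le_trans hk; apply: le_trans (_ : B * (w + n)%:R * lnp <= _).
  by rewrite -mulrA ler_wpM2l // natrD mulrDl lerD2r.
by rewrite ler_pM2r.
Qed.

Lemma entropy_union n : h n [set: F] <= h n D + n%:R * lnp.
Proof.
have p0 : 0 < p%:R :> R by rewrite ltr0n prime_gt0.
rewrite mulr_natl -lnXn // -lnM ?posrE ?zi_gt0 ?exprn_gt0 //.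
rewrite ler_ln ?posrE ?zi_gt0 ?mulr_gt0 ?zi_gt0 ?exprn_gt0 //.
by rewrite -natrX -natrM ler_nat; apply: zindex_engel_union.
Qed.

Variable al : R.
Hypothesis al01 : 0 <= al <= 1.

(** Containment in some [E m] is what keeps the chain of subgroups from becoming stationary above
    the target. *)
Definition admissible_state n K := [/\ subgroup K, exists m, K `<=` E m &
  al * h n D <= h n K].

Lemma entropy_step n K : admissible_state n K ->
  exists K', [/\ admissible_state n.+1 K', K `<=` K', K' `<=` mulset K (Z n) &
    K' = K \/ h n.+1 K' <= al * h n.+1 D + lnp].
Proof.
move=> [sK [m Km] hK]; have /andP[al0 al1] := al01.
have [Z1 _ _] : subgroup (Z n) by apply: (zassenhaus_subgroup p_pr cF hF n).1.
(* Each adjunction strictly lowers the gap between the indices of [K] and [D] at level [n.+1]. *)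
have [b] := ubnP (zindex p n.+1 D - zindex p n.+1 K); elim: b K m sK Km hK => // b IH K m sK Km hK.
rewrite ltnS => Kb.
have KD : K `<=` D by apply: classical_sets.subset_trans Km (@engel_group_union _ _ c m).
have [le|lt] := leP (al * h n.+1 D) (h n.+1 K).
  exists K; split=> //; [by split=> //; exists m|exact: subset_mulsetl|by left].
(* If nothing is left to adjoin, [h D - h K] is the same at both levels. At level [n] it is at most
   [(1 - al) * h n D], hence at most [(1 - al) * h n.+1 D], against [lt]. *)
have [ex|] := pselect (D `&` Z n `<=` mulset K (Z n.+1)).
  have /(congr1 (fun x => ln x%:R : R)) := zindex_exhausted p_pr cF hF fgF sD sK KD ex.
  rewrite !natrM !lnM ?posrE ?zi_gt0 // => eqh.
  have hS : h n D <= h n.+1 D by apply: entropy_le => //; apply: zindexS.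
  have := ler_wpM2l (_ : 0 <= 1 - al) hS; rewrite subr_ge0 al1 => /(_ isT).
  move: hK lt; rewrite /entropy in eqh *; lra.
move=> /existsNP[z /not_implyP[[Dz Zz] nKz]].
have [K'Z K'p K'lt] := zindex_adjoin p_pr cF hF fgF sK Zz; set K1 := sgen _ in K'Z K'p K'lt.
have sK1 : subgroup K1 by apply: sgen_subgroup.
have KK1 : K `<=` K1 by move=> x Kx; apply: mem_sgen; left.
have [mz Ez] := engel_union_group Dz.
have K1m : K1 `<=` E (maxn m mz).
  apply: sgen_sub; first exact: sE.
  move=> x [/Km Kx|->]; first by apply: engel_group_sub Kx; apply: leq_maxl.
  by apply: engel_group_sub Ez; apply: leq_maxr.
have hK1 : al * h n D <= h n K1 by apply: le_trans hK _; apply: entropy_mono.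
have p0 : 0 < p%:R :> R by rewrite ltr0n prime_gt0.
have hK1p : h n.+1 K1 <= h n.+1 K + lnp.
  rewrite addrC -lnM ?posrE ?zi_gt0 // ler_ln ?posrE ?mulr_gt0 ?zi_gt0 //.
  by rewrite -natrM ler_nat.
have [|K' [adK' K1K' K'K1 dich]] := IH K1 _ sK1 K1m hK1.
  apply: leq_trans Kb; apply: ltn_sub2l; last exact: K'lt.
  apply: leq_trans (K'lt nKz) _; apply: zindex_mono => //.
  by apply: classical_sets.subset_trans K1m (@engel_group_union _ _ c _).
exists K'; split=> //.
- exact: classical_sets.subset_trans KK1 K1K'.
- apply: classical_sets.subset_trans K'K1 _; apply: mulset_sub => //.
    apply: mulset_subgroup => //; last exact: zassenhaus_conj.
    exact: (zassenhaus_subgroup p_pr cF hF n).1.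
  by apply: subset_mulsetr; case: sK.
(* If the recursion stops at [K1], the last adjunction started below the target and overshoots by at
   most [lnp]. *)
- right; case: dich => [->|//]; lra.
Qed.

Lemma zindexT n : group_index [set: F] (Z n) = zindex p n [set: F].
Proof.
rewrite /zindex (_ : mulset [set: F] (Z n) = [set: F]) //.
apply/seteqP; split=> // x _; apply: subset_mulsetl => //.
by case: (zassenhaus_subgroup p_pr cF hF n) => -[].
Qed.

Lemma hdimE H : hdim R p Z H = limn_einf (fun n => (h n H / h n [set: F])%:E).
Proof.
rewrite /hdim; congr limn_einf; apply/funext => n; congr (_%:E).
rewrite zindexT /logp -/(zindex p n H) -/(h n H) -/(h n [set: F]) -/lnp.
by rewrite invfM invrK mulrACA mulVf ?mulr1 // gt_eqF.
Qed.

Lemma entropy_ratio_unit n H : subgroup H -> 0 <= h n H / h n [set: F] <= 1.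
Proof.
move=> sH; have a0 := entropy_ge0 n sT.
have Ha : h n H <= h n setT by apply: entropy_mono.
rewrite divr_ge0 ?entropy_ge0 //=.
(* If [Z n] is all of [F], the ratio is 0 / 0 and reads 0. *)
have [->|a1] := eqVneq (h n setT) 0; first by rewrite invr0 mulr0.
by rewrite ler_pdivrMr ?mul1r // lt_neqAle eq_sym a1.
Qed.

(** The case [B = e^-1] of the negligibility bound; requiring [n >= 1] also yields positivity and
    the bound on [lnp]. *)
Lemma entropy_engel_eventually m (e : R) : 0 < e -> exists N, forall n, (N <= n)%N ->
  [/\ 0 < h n [set: F], h n (E m) <= e * h n [set: F], n%:R * lnp <= e * h n [set: F] &
      lnp <= e * h n [set: F]].
Proof.
move=> e0; have eV : 0 <= e^-1 by rewrite invr_ge0 ltW.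
have [N hN] := entropy_engel_negligible m eV; exists (maxn N 1) => n.
rewrite geq_max => /andP[/hN/(ler_wpM2l (ltW e0)) + n1].
rewrite mulVKf ?gt_eqF // => le.
have n1' : 1 <= n%:R :> R by rewrite ler1n.
have nl : lnp <= n%:R * lnp by rewrite ler_peMl // ltW.
have hE0 := entropy_ge0 n (sE m); have l0 := lnp_gt0.
have pos : 0 < e * h n setT by lra.
split; [by rewrite pmulr_rgt0 in pos|lra..].
Qed.

Lemma interpolation : exists2 K, closed_subgroup K & hdim R p Z K = al%:E.
Proof.
have /andP[al0 al1] := al01.
have Zsub n := zassenhaus_subgroup p_pr cF hF n.
have Zconj n := zassenhaus_conj p_pr cF hF (i := n).
have : forall nK : nat * set F, exists K', admissible_state nK.1 nK.2 ->
    [/\ admissible_state nK.1.+1 K', nK.2 `<=` K', K' `<=` mulset nK.2 (Z nK.1) &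
    K' = nK.2 \/ h nK.1.+1 K' <= al * h nK.1.+1 D + lnp].
  move=> [n K] /=; have [adm|nadm] := pselect (admissible_state n K).
    by have [K' HK'] := entropy_step adm; exists K'.
  by exists K.
move=> /choice[f fP].
pose Ks := fix Ks n := if n is n'.+1 then f (n', Ks n') else [set 1%g].
(* At level 0 every subgroup has entropy 0, since [Z 0] is the whole of [F]. *)
have Ks0 : admissible_state 0 (Ks 0%N).
  have s1 : subgroup [set 1%g : F] by case: (closed_normal1 hF) => -[].
  split=> //.
    by exists 0%N => x ->; case: (sE 0).
  have : h 0 D <= h 0 [set 1%g].
    apply: entropy_le => //; apply: zindex_le_mulset => // x _.
    by exists 1%g => //; exists x => //; rewrite mul1g.
  by have := entropy_ge0 0 sD => h0; apply: le_trans; rewrite ler_piMl.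
have adm n : admissible_state n (Ks n).
  by elim: n => // n IH; have [] := fP (n, Ks n) IH.
have KsS n : Ks n `<=` Ks n.+1 by have [] := fP (n, Ks n) (adm n).
have KsZ n : Ks n.+1 `<=` mulset (Ks n) (Z n) by have [] := fP (n, Ks n) (adm n).
have Ks_dich n : Ks n.+1 = Ks n \/ h n.+1 (Ks n.+1) <= al * h n.+1 D + lnp.
  by have [] := fP (n, Ks n) (adm n).
have Ks_sub n : subgroup (Ks n) by case: (adm n).
pose K := topgen (\bigcup_n Ks n).
have cK : closed_subgroup K by apply: topgen_closed_subgroup.
have KsK n : Ks n `<=` K by move=> x Kx; apply: mem_topgen; exists n.
(* All later stages lie in [Ks n] times [Z n]. This subgroup is open, hence closed, so it contains
   the closure [K] as well. *)
have Kn n : zindex p n K = zindex p n (Ks n).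
  apply/eqP; rewrite eqn_leq; apply/andP; split; last exact: zindex_mono.
  apply: zindex_le_mulset => //.
  have sKZ : subgroup (mulset (Ks n) (Z n)) by apply: mulset_subgroup => //; case: (Zsub n).
  apply: topgen_sub.
    split=> //; apply: open_subgroup_closed => //.
    rewrite (_ : mulset _ _ = \bigcup_(k in Ks n) [set (k * z)%g | z in Z n]).
      by apply: bigcup_open => k _; apply: open_left_coset; apply: zassenhaus_open.
    by apply/seteqP; split=> [_ [k Kk [z Zz <-]]|_ [k Kk [z Zz <-]]];
      exists k => //; exists z.
  move=> x [j _]; have [jn|/ltnW nj] := leqP j n.
    move=> Kx; apply: subset_mulsetl; first by case: (Zsub n) => -[].
    elim: n jn {sKZ} => [|n IH]; first by rewrite leqn0 => /eqP <-.
    by rewrite leq_eqVlt => /predU1P[<- //|/IH]; apply: KsS.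
  elim: j nj x => [|j IH] nj x.
    move: nj; rewrite leqn0 => /eqP n0 Kx; apply: subset_mulsetl; first by case: (Zsub n) => -[].
    by rewrite n0.
  move: nj; rewrite leq_eqVlt => /predU1P[->|nj] Kx.
    by apply: subset_mulsetl Kx; case: (Zsub j.+1) => -[].
  have [k /IH-/(_ nj) Kk [z Zz <-]] := KsZ _ _ Kx.
  have [_ HM _] := sKZ; apply: HM => //; apply: subset_mulsetr; first by case: (Ks_sub n).
  exact: zassenhaus_anti Zz.
have hK n : h n K = h n (Ks n) by rewrite /entropy Kn.
exists K => //; rewrite hdimE; apply: limn_einf_fin_eq => e e0.
  (* Lower bound: [h n K >= al * h n D], and [D] loses at most [n%:R * lnp <= e * h n F] against
     [F]. *)
  have [N hN] := entropy_engel_eventually 0 e0; exists N => n /hN[a0 _ nl _].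
  rewrite ler_pdivlMr // hK; have [_ _] := adm n; apply: le_trans.
  have := entropy_union n; have := ler_wpM2l al0 nl.
  have := ler_wpM2r (ltW a0) (ler_wpM2r (ltW e0) al1).
  rewrite mul1r => i1 i2 i3; have := ler_wpM2l al0 i3; rewrite !mulrDr !mulrBl; lra.
(* Upper bound: suppose that the ratio exceeds [al + e] from [N] on. *)
move=> N; apply: contrapT => hi.
have {}hi n : (N <= n)%N -> al + e < h n K / h n setT.
  by move=> Nn; rewrite ltNge; apply/negP => le; apply: hi; exists n.
have [N1 hN1] := entropy_engel_eventually 0 e0.
pose N2 := maxn N N1.
(* A change of the chain beyond [N2] would bring the value down to [al * h D + lnp], at most
   [al + e] times [h F]; so none occurs. *)
have Ks_const n : (N2 <= n)%N -> Ks n = Ks N2.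
  elim: n => [|n IH]; first by rewrite leqn0 => /eqP->.
  rewrite leq_eqVlt => /predU1P[<- //|n2]; rewrite -(IH n2).
  have Nn : (N <= n)%N by apply: leq_trans (leq_maxl N N1) n2.
  have N1n : (N1 <= n)%N by apply: leq_trans (leq_maxr N N1) n2.
  case: (Ks_dich n) => // le; have [a0 _ _ lp] := hN1 _ (leqW N1n).
  have := hi _ (leqW Nn); rewrite ltr_pdivlMr // hK mulrDl ltNge => /negP; case.
  apply: le_trans le _; apply: lerD => //; apply: ler_wpM2l => //.
  exact: entropy_mono.
(* The chain is then stuck in one [E m], whose entropy eventually is at most [e] times that of
   [F]. *)
have [_ [m Km] _] := adm N2.
have [N3 hN3] := entropy_engel_eventually m e0.
pose n := maxn N2 N3.
have [a0 hE _ _] := hN3 n (leq_maxr _ _).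
have Nn : (N <= n)%N by rewrite /n /N2 -maxnA leq_maxl.
have := hi n Nn; rewrite ltr_pdivlMr // hK Ks_const ?leq_maxl // ltNge => /negP; case.
apply: le_trans (_ : h n (E m) <= _); first exact: entropy_mono.
by apply: le_trans hE _; rewrite ler_pM2r // lerDr.
Qed.
End Interpolation.

Theorem theorem1p3 (R : realType) (p : nat) (F : topGroupType) :
  prime p ->
  free_pro_p p F -> finitely_generated F -> nonabelian F ->
  hspec R p (zassenhaus p F) = EFin @` `[0, 1].
Proof.
move=> p_pr freeF fgF nab.
have [cF hF] : compact [set: F] /\ hausdorff_space F.
  by case: freeF => X [b [[]]].
have [d [c [c_hom c_gen]]] := finite_free_basis p_pr freeF fgF nab.
apply/seteqP; split=> [_ [H [sH _] <-]|_ [r r01 <-]].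
  rewrite hdimE //.
  have [r r01 ->] := limn_einf_unit_interval
    (fun n => entropy_ratio_unit R p_pr cF hF fgF n sH).
  by exists r; rewrite //= in_itv.
have [K cK <-] := @interpolation R p F d c p_pr cF hF fgF c_hom c_gen r r01.
by exists K.
Qed.
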